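(* Let $X_i=\theta_i+\varepsilon_i$, $i=1,\dots,n$, with $\varepsilon_i$ i.i.d. $N(0,1)$. Assume that as $n\to\infty$, $s_n\to\infty$, $n/s_n\to\infty$, $\alpha_n\to0$ and $\log(1/\alpha_n)=o\{\sqrt{\log(n/s_n)}\}$. Fix $b\in\mathbb R$. Then the GBS procedure $\varphi^{\mathrm{GBS}}$ at nominal level $\alpha_n$ satisfies $$\sup_{\theta\in\Theta_b}\mathbb E_\theta\{\mathrm{FDP}(\theta,\varphi^{\mathrm{GBS}})+\mathrm{FNP}(\theta,\varphi^{\mathrm{GBS}})\}\le\bar\Phi(b)+o(1).$$ Consequently, the GBS procedure is sharply asymptotically minimax under $\mathrm{FDP}+\mathrm{FNP}$ loss over $\Theta_b$, i.e. $$\sup_{\theta\in\Theta_b}\mathbb E_\theta\{\mathrm{FDP}(\theta,\varphi^{\mathrm{GBS}})+\mathrm{FNP}(\theta,\varphi^{\mathrm{GBS}})\}=\mathcal R_F(\Theta_b)+o(1).$$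
   Context: Here $(s_n)$ is a sequence of positive integers with $s_n\le n$ and $\alpha_n\in(0,1)$. $\Phi$ is the standard normal distribution function and $\bar\Phi=1-\Phi$. For $\theta\in\mathbb R^n$, $S_\theta=\{i:\theta_i\ne0\}$. The beta-min class is $$\Theta_b=\{\theta\in\mathbb R^n:|S_\theta|=s_n,\ |\theta_i|\ge\sqrt{2\log(n/s_n)}+b\ \text{for all } i\in S_\theta\}.$$ One tests $H_{0i}:\theta_i=0$ versus $H_{1i}:\theta_i\ne0$, $i=1,\dots,n$. A multiple testing procedure is a (measurable) function $\varphi=(\varphi_1,\dots,\varphi_n)\in\{0,1\}^n$ of the data $X=(X_1,\dots,X_n)$, with $\varphi_i=1$ meaning that $H_{0i}$ is rejected. Put $V(\theta,\varphi)=\sum_{i:\theta_i=0}\varphi_i$, $T(\theta,\varphi)=\sum_{i:\theta_i\ne0}(1-\varphi_i)$, $$\mathrm{FDP}(\theta,\varphi)=\frac{V(\theta,\varphi)}{\max\{1,\sum_{i=1}^n\varphi_i\}},\qquad \mathrm{FNP}(\theta,\varphi)=\frac{T(\theta,\varphi)}{\max\{1,s_n\}},$$ and $\mathcal R_F(\Theta_b)=\inf_\varphi\sup_{\theta\in\Theta_b}\mathbb E_\theta\{\mathrm{FDP}(\theta,\varphi)+\mathrm{FNP}(\theta,\varphi)\}$, the infimum being over all multiple testing procedures. Sharp asymptotic minimaxity of a procedure means that its maximal risk over the class equals the minimax risk up to $o(1)$. GBS (Gavrilov--Benjamini--Sarkar) step-down procedure: let $P_i=2\bar\Phi(|X_i|)$,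 with ordered values $P_{(1)}\le\dots\le P_{(n)}$, and $c_j=\dfrac{j\alpha_n}{n+1-j(1-\alpha_n)}$, $j=1,\dots,n$. Let $R_n^{\mathrm{GBS}}=\max\{r:P_{(j)}\le c_j\text{ for every }1\le j\le r\}$ ($=0$ if the set is empty). $\varphi^{\mathrm{GBS}}$ rejects exactly the hypotheses corresponding to $P_{(1)},\dots,P_{(R_n^{\mathrm{GBS}})}$. *)

(* Defs.v *)
From mathcomp Require Export all_boot all_order all_algebra.
From mathcomp Require Export all_classical all_reals all_analysis.
Export Order.TTheory GRing.Theory Num.Theory.
Export numFieldNormedType.Exports.

Set Implicit Arguments.
Unset Strict Implicit.
Unset Printing Implicit Defensive.

Local Open Scope classical_set_scope.
Local Open Scope ring_scope.

Definition Phi (R : realType) (x : R) : R :=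
  fine (normal_prob (0 : R) 1 `]-oo, x]).

Definition Phibar (R : realType) (x : R) : R := 1 - Phi x.

(* Mutual independence: the product rule holds along every subfamily J. *)
Definition mutually_independent (d : measure_display) (T : measurableType d)
    (R : realType) (P : probability T R) (n : nat)
    (X : 'I_n -> {RV P >-> R}) : Prop :=
  forall (J : {set 'I_n}) (A : 'I_n -> set R),
    (forall i, measurable (A i)) ->
    P (\bigcap_(i in [set` J]) (X i @^-1` A i))
      = (\prod_(i in J) P (X i @^-1` A i))%E.

Definition iid_std_normal (d : measure_display) (T : measurableType d)
    (R : realType) (P : probability T R) (n : nat)
    (eps : 'I_n -> {RV P >-> R}) : Prop :=
  (forall (i : 'I_n) (A : set R), measurable A ->
     distribution P (eps i) A = normal_prob (0 : R) 1 A)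
  /\ mutually_independent eps.

(* R^n is represented by n.-tuple R, which carries the product sigma-algebra. *)
Definition observation (d : measure_display) (T : measurableType d)
    (R : realType) (P : probability T R) (n : nat)
    (eps : 'I_n -> {RV P >-> R}) (theta : n.-tuple R) (w : T) : n.-tuple R :=
  [tuple tnth theta i + eps i w | i < n].

Definition signals (R : realType) (n : nat) (theta : n.-tuple R) : {set 'I_n} :=
  [set i | tnth theta i != 0]%SET.

Definition Theta_b (R : realType) (n s : nat) (b : R) : set (n.-tuple R) :=
  [set theta | #|signals theta| = s /\
     forall i, i \in signals theta ->
       Num.sqrt (2 * ln (n%:R / s%:R)) + b <= `|tnth theta i| ].

(* Rejection decisions are n.-tuple bool; a multiple testing procedure is a
   measurable map from the sample space n.-tuple R. *)
Definition procedure (R : realType) (n : nat) : set (n.-tuple R -> n.-tuple bool) :=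
  [set phi | measurable_fun [set: n.-tuple R] phi].

Definition false_rejections (R : realType) (n : nat) (theta : n.-tuple R)
    (phi : n.-tuple bool) : nat :=
  (\sum_(i < n | tnth theta i == 0%R) tnth phi i)%N.

Definition missed_signals (R : realType) (n : nat) (theta : n.-tuple R)
    (phi : n.-tuple bool) : nat :=
  (\sum_(i < n | tnth theta i != 0%R) (1 - tnth phi i))%N.

Definition FDP (R : realType) (n : nat) (theta : n.-tuple R)
    (phi : n.-tuple bool) : R :=
  (false_rejections theta phi)%:R / (maxn 1 (\sum_(i < n) tnth phi i))%:R.

Definition FNP (R : realType) (n s : nat) (theta : n.-tuple R)
    (phi : n.-tuple bool) : R :=
  (missed_signals theta phi)%:R / (maxn 1 s)%:R.

Definition risk (d : measure_display) (T : measurableType d)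
    (R : realType) (P : probability T R) (n : nat)
    (eps : 'I_n -> {RV P >-> R}) (s : nat)
    (phi : n.-tuple R -> n.-tuple bool) (theta : n.-tuple R) : \bar R :=
  ('E_P[fun w => let X := observation eps theta w in
                 (FDP theta (phi X) + FNP s theta (phi X))%R])%E.

Definition max_risk (d : measure_display) (T : measurableType d)
    (R : realType) (P : probability T R) (n : nat)
    (eps : 'I_n -> {RV P >-> R}) (s : nat) (b : R)
    (phi : n.-tuple R -> n.-tuple bool) : \bar R :=
  ereal_sup [set risk eps s phi theta | theta in @Theta_b R n s b].

Definition minimax_risk (d : measure_display) (T : measurableType d)
    (R : realType) (P : probability T R) (n : nat)
    (eps : 'I_n -> {RV P >-> R}) (s : nat) (b : R) : \bar R :=
  ereal_inf [set max_risk eps s b phi | phi in @procedure R n].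

Definition p_value (R : realType) (x : R) : R := 2 * Phibar `|x|.

Definition p_values (R : realType) (n : nat) (X : n.-tuple R) : seq R :=
  [seq p_value x | x <- X].

(* sorted_p_values X lists P_(1) <= ... <= P_(n), so that P_(j) is its entry
   of index j.-1. *)
Definition sorted_p_values (R : realType) (n : nat) (X : n.-tuple R) : seq R :=
  sort <=%R (p_values X).

Definition gbs_crit (R : realType) (n : nat) (alpha : R) (j : nat) : R :=
  j%:R * alpha / (n%:R + 1 - j%:R * (1 - alpha)).

(* The ordinal j < n stands for the 1-based rank j.+1. *)
Definition gbs_count (R : realType) (n : nat) (alpha : R) (X : n.-tuple R) : nat :=
  (\max_(r < n.+1 | [forall j : 'I_n, (j < r)%N ==>
       (nth 0%R (sorted_p_values X) j <= gbs_crit n alpha j.+1)%R]) r)%N.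

(* H_{0i} is rejected when P_i is one of the gbs_count X smallest p-values.
   Since gbs_crit n alpha is increasing in j on 1..n, P_(R) = P_(R+1) would give
   P_(R+1) <= c_(R+1), contradicting the maximality of R = gbs_count X; so no
   tie straddles rank R and exactly gbs_count X hypotheses are rejected. *)
Definition gbs (R : realType) (n : nat) (alpha : R) (X : n.-tuple R) : n.-tuple bool :=
  [tuple p_value (tnth X i) \in take (gbs_count alpha X) (sorted_p_values X)
     | i < n].

(* Main.v *)
Require Import Defs.
From mathcomp Require Import measurable_realfun ring lra.

(** Write a = sqrt (2 ln (n / s)), let mu = a + b be the smallest amplitude of a
signal, and let Phibar be the Gaussian tail. Both the maximal risk of GBS and
the minimax risk tend to Phibar b: a signal of amplitude mu is detectable when
it exceeds the level a, up to o(1), and misses this level with probability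
close to Phibar b.

Upper bound ([gbs_risk_bound]). Fix t = a + delta with delta > 0. With
probability tending to one GBS rejects every signal that exceeds t by its noise,
and the number of its false rejections is o(s). For the first point, at ranks of
order s the critical value is of order alpha s / n, which is larger than
2 Phibar t because ln (1 / alpha) = o(a); so the only danger is that the
step-down stops at an earlier rank j. There the critical value c_j is
2 Phibar z with z > t, and the monotone likelihood ratio of the Gaussian shift
([Phibar_shift_ratio]) says that going from level t to level z decreases the
power at most in proportion to the p-value threshold. Hence at least M j signals
are expected to have a p-value below c_j, with M tending to infinity. Chebyshev's
inequality ([count_lower_tail]) at the dyadic ranks, whose failure probabilities
form a geometric series, then excludes an early stop at any rank. For the second
point, only about 2 alpha s nulls have a p-value below c_(2 s): this is too few
to reach rank 2 s, so that all false rejections are among these nulls, while the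
number of rejections is of order s.

Lower bound ([minimax_lower]). Rejecting more than K s hypotheses costs at least
1 - 1 / K in FDP. Replacing such decisions by no rejection makes the loss at
least (1 - 1 / K) times the linear loss (T + V / K) / s ([loss_ge_weighted]). A
linear loss can be averaged over the uniform distribution on supports of size s,
all signals being equal to mu. Taking one element off the support
([sum_remove_add]) turns the average into a sum of testing problems: given the
other s - 1 signals, is the last one at k, or elsewhere? By the formula for the
likelihood ratio of a shift of one coordinate ([shift_likelihood]) no test
detects the signal at k when x_k is slightly below a while at least half of the
expected number of other coordinates exceeds a - delta, since these jointly
carry more likelihood ([testing_lower]). Under a signal at k this event has probability
close to Phibar b ([hard_set_prob]). *)

Set Implicit Arguments.
Unset Strict Implicit.
Unset Printing Implicit Defensive.

Local Open Scope classical_set_scope.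
Local Open Scope ring_scope.

(** * Integration against a density *)

Section density.
Context d (T : measurableType d) (R : realType).
Variables (m1 m2 : {measure set T -> \bar R}) (g : T -> R).
Hypotheses (mg : measurable_fun setT g) (g0 : forall x, 0 <= g x).
Hypothesis m2E : forall A, measurable A -> m2 A = (\int[m1]_(x in A) (g x)%:E)%E.
Local Open Scope ereal_scope.
Import HBNNSimple.

(** Level sets reduce the case of simple functions to [m2E]; the general case
follows by monotone convergence. *)
Lemma integral_density (D : set T) (f : T -> \bar R) :
  measurable D -> measurable_fun D f -> (forall x, 0 <= f x) ->
  \int[m2]_(x in D) f x = \int[m1]_(x in D) (f x * (g x)%:E).
Proof.
move=> mD mf f0; pose h := nnsfun_approx mD mf.
have mgE : measurable_fun setT (EFin \o g) by exact/measurable_EFinP.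
have -> : \int[m2]_(x in D) f x =
    lim (\int[m2]_(x in D) (EFin \o h n) x @[n --> \oo]).
  have fE x : D x -> f x = lim ((EFin \o h n) x @[n --> \oo]).
    by move=> Dx; apply/esym/cvg_lim => //; exact: cvg_nnsfun_approx.
  under eq_integral => x /[!inE] /fE -> //.
  apply: monotone_convergence => //.
  - by move=> n; apply/measurable_EFinP/measurable_funTS.
  - by move=> n x Dx //=; rewrite lee_fin.
  - by move=> x Dx a b ab; rewrite lee_fin; exact/lefP/nd_nnsfun_approx.
have -> : \int[m1]_(x in D) (f x * (g x)%:E) =
    lim (\int[m1]_(x in D) ((EFin \o h n) x * (g x)%:E) @[n --> \oo]).
  have fg x : D x -> f x * (g x)%:E = lim ((EFin \o h n) x * (g x)%:E @[n --> \oo]).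
    by move=> Dx; apply/esym/cvg_lim => //; apply: cvgeZr => //;
      exact: cvg_nnsfun_approx.
  under eq_integral => x /[!inE] /fg -> //.
  apply: monotone_convergence => [//| | |].
  - move=> n; apply/emeasurable_funM; apply/measurable_funTS => //.
    exact/measurable_EFinP.
  - by move=> n x Dx /=; rewrite mule_ge0 ?lee_fin.
  - move=> x Dx a b ab/=; rewrite lee_wpmul2r ?lee_fin//.
    exact/lefP/nd_nnsfun_approx.
apply: congr_lim; apply/funext => n.
transitivity (\int[m2]_(x in D)
   (\sum_(y \in range (h n)) (y * \1_(h n @^-1` [set y]) x)%:E)).
  by apply: eq_integral => t tD; rewrite /= fimfunE -fsumEFin.
have indich r : measurable_fun D (fun x => (r * \1_(h n @^-1` [set r]) x)%:E).
  by apply: (measurable_comp measurableT) => //; exact: measurable_funM.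
rewrite ge0_integral_fsum//; last by move=> y x _; exact: nnfun_muleindic_ge0.
transitivity (\int[m1]_(x in D) (\sum_(y \in range (h n))
    (y * \1_(h n @^-1` [set y]) x)%:E * (g x)%:E)); last first.
  under [RHS]eq_integral => x xD.
    rewrite /= fimfunE -fsumEFin// ge0_mule_fsuml => [|y]; last exact: nnfun_muleindic_ge0.
    over.
  by [].
rewrite ge0_integral_fsum//; last 2 first.
  - by move=> y; apply: emeasurable_funM => //; exact: measurable_funTS.
  - by move=> y x Dx; rewrite mule_ge0 ?lee_fin// -lee_fin nnfun_muleindic_ge0.
apply: eq_fsbigr => r rhn.
under [LHS]eq_integral do rewrite EFinM.
rewrite integralZl_indic_nnsfun => //.
under [RHS]eq_integral do rewrite EFinM -muleA.
have r0 : (0 <= r)%R by move: rhn; rewrite inE => -[x _ <-].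
rewrite ge0_integralZl//.
- congr (_ * _); under [RHS]eq_integral do rewrite muleC.
  rewrite [RHS](eq_integral ((EFin \o g) \_ (h n @^-1` [set r]))); last first.
    by move=> x xD; rewrite epatch_indic.
  by rewrite -integral_mkcondr -m2E ?integral_indic// 1?setIC//; exact: measurableI.
- apply: emeasurable_funM; last exact: measurable_funTS.
  exact/measurable_EFinP.
- by move=> x _; rewrite mule_ge0 ?lee_fin.
Qed.
End density.

(** * The standard Gaussian tail *)

Section gaussian.
Context (R : realType).
Implicit Types (x y z c : R) (A : set R).
Local Notation N := (@normal_prob R 0 1).
Local Notation lambda := (@lebesgue_measure R).
Local Notation phi := (@normal_pdf R 0 1).

Lemma std_pdfE x : phi x = normal_peak 1 * expR (- (x ^+ 2 / 2)).
Proof.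
rewrite normal_pdfE ?oner_neq0// /normal_fun subr0.
by rewrite expr1n mulNr.
Qed.

Lemma std_pdf_shift c x : phi (x - c) = expR (c * x - c ^+ 2 / 2) * phi x.
Proof.
rewrite !std_pdfE mulrCA -expRD; congr (_ * expR _); lra.
Qed.

Lemma lebesgue_shift c A : measurable A ->
  pushforward lambda ((fun x => x + c) : _ -> measurableTypeR R) A = lambda A.
Proof.
move=> mA; apply/esym/lebesgue_measure_unique => //=.
  exact: measurable_funD.
move=> mf _ [[a b]] _ <-.
rewrite /pushforward.
have -> : (fun x => x + c) @^-1` [set` `]a, b]%R] = `]a - c, b - c]%classic.
  by apply/seteqP; split=> x /=; rewrite !in_itv/= ltrBlDr lerBrDr.
rewrite !lebesgue_measure_itv/= !lte_fin ltrD2r.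
by case: ifP => // _; rewrite -!EFinD; congr (_%:E); ring.
Qed.

(** Translating the standard Gaussian multiplies its density by the likelihood
ratio exp (c x - c ^ 2 / 2). The tail bound, the monotone likelihood ratio and
the change of measure on tuples all come from this identity. *)
Lemma normal_shift c A : measurable A ->
  N ((fun x => x + c) @^-1` A) =
  (\int[N]_(x in A) (expR (c * x - c ^+ 2 / 2))%:E)%E.
Proof.
move=> mA.
rewrite (@integral_density _ _ _ lambda N phi)//; last 3 first.
- exact: measurable_normal_pdf.
- by move=> x; exact: normal_pdf_ge0.
- apply/measurable_EFinP/measurable_funTS; apply: measurableT_comp => //.
  by apply: measurable_funB => //; exact: measurable_funM.
under eq_integral do rewrite -EFinM -std_pdf_shift.
have mc : measurable_fun setT ((fun x => x + c) : R -> measurableTypeR R).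
  exact: measurable_funD.
rewrite -(@eq_measure_integral _ _ _ _ lambda
  (pushforward lambda ((fun x => x + c) : _ -> measurableTypeR R))); last first.
  by move=> B mB _; first [exact: lebesgue_shift | exact/esym/lebesgue_shift].
rewrite ge0_integral_pushforward//; last 2 first.
- apply/measurable_EFinP/measurable_funTS.
  apply: measurableT_comp; first exact: measurable_normal_pdf.
  exact: measurable_funD.
- by move=> y _; rewrite lee_fin normal_pdf_ge0.
by rewrite /normal_prob; apply: eq_integral => x _ /=; rewrite addrK.
Qed.

Lemma normal_oppr A : measurable A -> N (-%R @^-1` A) = N A.
Proof.
move=> mA; rewrite /normal_prob.
rewrite -[RHS](@eq_measure_integral _ _ _ _ lambda
  (pushforward lambda (-%R : _ -> measurableTypeR R))); last first.
  by move=> B mB _; first [exact: lebesgue_measureN | exact/esym/lebesgue_measureN].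
rewrite ge0_integral_pushforward//; last 2 first.
- apply/measurable_EFinP/measurable_funTS.
  exact: measurable_normal_pdf.
- by move=> y _; rewrite lee_fin normal_pdf_ge0.
by apply: eq_integral => x _ /=; rewrite !std_pdfE sqrrN.
Qed.

Lemma normal_set1 x : N [set x] = 0%E.
Proof. by rewrite /normal_prob integral_set1. Qed.

Lemma Phi_EFin x : (Phi x)%:E = N `]-oo, x].
Proof. by rewrite /Phi fineK// fin_num_measure. Qed.

Lemma Phi_open x : (Phi x)%:E = N `]-oo, x[.
Proof.
rewrite Phi_EFin -(@setUitv1 _ _ -oo%O x true)//= measureU//=.
  by rewrite normal_set1 adde0.
by apply/seteqP; split => // y/= []; rewrite in_itv/= => /[swap] ->; rewrite ltxx.
Qed.

Lemma Phibar_open x : (Phibar x)%:E = N `]x, +oo[.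
Proof.
by rewrite /Phibar EFinB Phi_EFin -setCitvl probability_setC.
Qed.

Lemma Phibar_closed x : (Phibar x)%:E = N `[x, +oo[.
Proof.
by rewrite /Phibar EFinB Phi_open -setCitvl probability_setC.
Qed.

Lemma PhiN x : Phi (- x) = Phibar x.
Proof.
apply: EFin_inj; rewrite Phi_EFin Phibar_closed -normal_oppr//.
congr (N _); apply/seteqP; split => y /=; rewrite !in_itv/= andbT; lra.
Qed.

Lemma PhibarN x : Phibar (- x) = Phi x.
Proof. by rewrite -PhiN opprK. Qed.

Lemma Phi_ge0 x : 0 <= Phi x.
Proof. by rewrite -lee_fin Phi_EFin. Qed.

Lemma Phibar_ge0 x : 0 <= Phibar x.
Proof. by rewrite -PhiN Phi_ge0. Qed.

Lemma Phibar_le1 x : Phibar x <= 1.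
Proof. by rewrite /Phibar; have := Phi_ge0 x; lra. Qed.

Lemma Phibar_slice x y : x <= y -> (Phibar x - Phibar y)%:E = N `]x, y].
Proof.
move=> xy; rewrite EFinB !Phibar_open.
have -> : `]x, +oo[%classic = `]x, y] `|` `]y, +oo[ :> set R.
  apply/seteqP; split => z /=; rewrite !in_itv/= ?andbT.
    by move=> xz; have [zy|yz] := leP z y; [left; rewrite xz|right].
  by case=> [/andP[]//|]; exact: le_lt_trans.
rewrite measureU//= ?addeK ?fin_num_measure//.
apply/seteqP; split => // z/=; rewrite !in_itv/= andbT => -[/andP[_ zy] yz].
by move: (le_lt_trans zy yz); rewrite ltxx.
Qed.

Lemma Phibar_slice_ge c x y : x <= y ->
  (forall z, x < z <= y -> c <= phi z) -> 0 <= c ->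
  c * (y - x) <= Phibar x - Phibar y.
Proof.
move=> xy cphi c0; rewrite -lee_fin Phibar_slice// /normal_prob.
have -> : (c * (y - x))%:E = (\int[lambda]_(z in `]x, y]) c%:E)%E.
  rewrite integral_cst//= lebesgue_measure_itv/= lte_fin EFinM.
  have [_|yx] := ltP x y; first by rewrite EFinB.
  by have -> : y - x = 0 by lra.
apply: ge0_le_integral => //=.
by apply/measurable_EFinP/measurable_funTS; exact: measurable_normal_pdf.
Qed.

Lemma Phibar_slice_le c x y : x <= y ->
  (forall z, phi z <= c) ->
  Phibar x - Phibar y <= c * (y - x).
Proof.
move=> xy cphi; rewrite -lee_fin Phibar_slice// /normal_prob.
have -> : (c * (y - x))%:E = (\int[lambda]_(z in `]x, y]) c%:E)%E.
  rewrite integral_cst//= lebesgue_measure_itv/= lte_fin EFinM.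
  have [_|yx] := ltP x y; first by rewrite EFinB.
  by have -> : y - x = 0 by lra.
apply: ge0_le_integral => //=.
- by move=> z _; rewrite lee_fin normal_pdf_ge0.
- by apply/measurable_EFinP/measurable_funTS; exact: measurable_normal_pdf.
- by move=> z _; rewrite lee_fin.
Qed.

Lemma std_peak_le1 : normal_peak 1 <= 1 :> R.
Proof.
have p2 : 1 <= pi *+ 2 :> R by rewrite mulr2n; have := @pi_ge2 R; lra.
rewrite /normal_peak expr1n mul1r invf_le1.
  by rewrite -[leLHS]sqrtr1 ler_sqrt//; lra.
by rewrite sqrtr_gt0; lra.
Qed.

Lemma Phibar_lip x y : x <= y -> Phibar x - Phibar y <= y - x.
Proof.
move=> xy; rewrite -[leRHS]mul1r; apply: Phibar_slice_le => // z.
by rewrite (le_trans (normal_pdf_ub _ _ _))// ?std_peak_le1// oner_neq0.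
Qed.

Lemma Phibar_noninc x y : x <= y -> Phibar y <= Phibar x.
Proof. by move=> xy; rewrite -subr_ge0 -lee_fin Phibar_slice. Qed.

Lemma Phibar_dist x y : `|Phibar x - Phibar y| <= `|x - y|.
Proof.
wlog xy : x y / x <= y.
  move=> H; have [/H//|/ltW/H] := leP x y.
  by rewrite distrC (distrC y).
have := Phibar_noninc xy; have := Phibar_lip xy => L M.
by rewrite ger0_norm ?subr_ge0// distrC ger0_norm ?subr_ge0.
Qed.

Lemma Phibar_continuous : continuous (@Phibar R : R -> R).
Proof.
move=> x; apply/cvgrPdist_le => e e0; near=> y.
apply: le_trans (Phibar_dist _ _) _.
by near: y; apply: cvgr_dist_le.
Unshelve. all: by end_near. Qed.

Lemma std_pdf_noninc x y : 0 <= x -> x <= y -> phi y <= phi x.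
Proof.
move=> x0 xy; rewrite !std_pdfE ler_pM2l ?normal_peak_gt0 ?oner_neq0//.
by rewrite ler_expR lerN2 ler_pM2r ?invr_gt0// ler_sqr ?nnegrE//; lra.
Qed.

Lemma std_pdf_gt0 x : 0 < phi x.
Proof. by rewrite std_pdfE mulr_gt0 ?expR_gt0// normal_peak_gt0// oner_neq0. Qed.

(** Only the slice between x - e and x is kept, where the density is at least
[phi x]. The width e stays fixed in the application while x grows, so the loss
with respect to the true tail is exponentially small in x only, which is the
precision that is needed. *)
Lemma Phibar_lower x e : 0 <= x - e -> 0 <= e -> e * phi x <= Phibar (x - e).
Proof.
move=> x0 e0; have := @Phibar_slice_ge (phi x) (x - e) x.
move=> /(_ ltac:(lra)) H.
have {}H := H _ (ltW (std_pdf_gt0 x)).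
apply: le_trans (_ : Phibar (x - e) - Phibar x <= _); last first.
  by have := Phibar_ge0 x; lra.
rewrite mulrC [in leLHS](_ : e = x - (x - e)); last by lra.
by apply: H => z /andP[xz zx]; apply: std_pdf_noninc => //; lra.
Qed.

Lemma Phibar_lt x y : 0 <= x -> x < y -> Phibar y < Phibar x.
Proof.
move=> x0 xy; rewrite -subr_gt0.
apply: lt_le_trans (@Phibar_slice_ge (phi y) x y (ltW xy) _ (ltW (std_pdf_gt0 y))).
  by rewrite mulr_gt0 ?std_pdf_gt0 ?subr_gt0.
by move=> z /andP[xz zy]; apply: std_pdf_noninc => //; lra.
Qed.

Lemma Phibar_gt0 x : 0 < Phibar x.
Proof.
have [x0|x0] := leP 0 x.
  by apply: le_lt_trans (Phibar_ge0 (x + 1)) _; apply: Phibar_lt => //; lra.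
apply: lt_le_trans (Phibar_noninc (ltW x0)).
by apply: le_lt_trans (Phibar_ge0 1) _; apply: Phibar_lt => //; lra.
Qed.

Lemma Phibar0 : Phibar 0 = 1 / 2 :> R.
Proof. by have := PhiN 0; rewrite oppr0 /Phibar; lra. Qed.

Let mweight c A : measurable_fun A (fun x => (expR (c * x - c ^+ 2 / 2))%:E).
Proof.
apply/measurable_EFinP/measurable_funTS; apply: measurableT_comp => //.
by apply: measurable_funB => //; exact: measurable_funM.
Qed.

Lemma normal_shift_le c A k : measurable A ->
  (forall x, A x -> c * x - c ^+ 2 / 2 <= k) ->
  (N ((fun x => (x + c)%R) @^-1` A) <= (expR k)%:E * N A)%E.
Proof.
move=> mA Ak; rewrite normal_shift// -integral_cst//.
apply: ge0_le_integral => //=; first exact: mweight.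
by move=> t At; rewrite lee_fin ler_expR Ak.
Qed.

Lemma normal_shift_ge c A k : measurable A ->
  (forall x, A x -> k <= c * x - c ^+ 2 / 2) ->
  ((expR k)%:E * N A <= N ((fun x => (x + c)%R) @^-1` A))%E.
Proof.
move=> mA Ak; rewrite normal_shift// -integral_cst//.
apply: ge0_le_integral => //=; first exact: mweight.
by move=> t At; rewrite lee_fin ler_expR Ak.
Qed.

Lemma shift_preimage_ray c z :
  (fun x => x + c) @^-1` `]z, +oo[ = `](z - c), +oo[%classic :> set R.
Proof. by apply/seteqP; split=> x /=; rewrite !in_itv/= !andbT ltrBlDr. Qed.

(** The half-line above x is the half-line above 0 shifted by x, and there the
likelihood ratio of the shift is at most exp (- x ^ 2 / 2). *)
Lemma Phibar_tail x : 0 <= x -> Phibar x <= expR (- (x ^+ 2 / 2)).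
Proof.
move=> x0; rewrite -lee_fin Phibar_open.
have := @normal_shift_le (- x) `]0, +oo[ (- (x ^+ 2 / 2)).
rewrite shift_preimage_ray opprK add0r => H; apply: le_trans (H _ _) _ => //.
  move=> y /=; rewrite in_itv/= andbT => y0.
  by have := mulr_ge0 x0 (ltW y0); nra.
rewrite -Phibar_open -EFinM lee_fin ler_piMr ?expR_ge0// Phibar_le1//.
Qed.

(** Monotone likelihood ratio: the ratio exp (c z - c ^ 2 / 2) is at most its
value at y on the slice between x and y, and at least this value above y. For
the one-sided tests of the shift c this is the concavity of the power as a
function of the level. *)
Lemma Phibar_shift_ratio c x y : 0 <= c -> x <= y ->
  Phibar (x - c) * Phibar y <= Phibar (y - c) * Phibar x.
Proof.
move=> c0 xy; set k := c * y - c ^+ 2 / 2.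
have lo : expR k * Phibar y <= Phibar (y - c).
  rewrite -lee_fin EFinM !Phibar_open -shift_preimage_ray.
  apply: normal_shift_ge => // z /=; rewrite in_itv/= andbT => yz.
  by rewrite /k lerB// ler_wpM2l// ltW.
have hi : Phibar (x - c) - Phibar (y - c) <= expR k * (Phibar x - Phibar y).
  rewrite -lee_fin EFinM !Phibar_slice//; last by lra.
  have -> : `](x - c), (y - c)]%classic = (fun z => z + c) @^-1` `]x, y] :> set R.
    by apply/seteqP; split=> z /=; rewrite !in_itv/= ltrBlDr lerBrDr.
  apply: normal_shift_le => // z /=; rewrite in_itv/= => /andP[xz zy].
  by rewrite /k lerB// ler_wpM2l// ltW.
have B0 := Phibar_ge0 y; have AB := Phibar_noninc xy.
have h1 : (Phibar (x - c) - Phibar (y - c)) * Phibar y <=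
    expR k * (Phibar x - Phibar y) * Phibar y by rewrite ler_wpM2r.
have h2 : expR k * Phibar y * (Phibar x - Phibar y) <=
    Phibar (y - c) * (Phibar x - Phibar y) by rewrite ler_wpM2r// subr_ge0.
lra.
Qed.

Lemma Phibar_quantile c : 0 < c <= 1 -> exists2 z, 0 <= z & 2 * Phibar z = c.
Proof.
move=> /andP[c0 c1]; pose M := 1 + 4 / c.
have cV : 0 < c^-1 by rewrite invr_gt0.
have M0 : 0 <= M by rewrite /M; lra.
have PM : Phibar M <= c / 2.
  apply: le_trans (Phibar_tail M0) _; rewrite expRN.
  have M1 : 0 < M by rewrite /M; lra.
  apply: le_trans (_ : (2 / c)^-1 <= _); last by rewrite invf_div.
  rewrite lef_pV2 ?posrE ?expR_gt0 ?divr_gt0//.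
  apply: le_trans (expR_ge1Dx _).
  have : 4 / c <= M by rewrite /M; lra.
  have : 1 <= M by rewrite /M; lra.
  nra.
have [] := @IVT R (@Phibar R) 0 M (c / 2) M0.
- by apply: continuous_subspaceT => x; exact: Phibar_continuous.
- by rewrite Phibar0 min_r ?max_l; lra.
by move=> z; rewrite in_itv/= => /andP[z0 _] zE; exists z => //; lra.
Qed.

End gaussian.

(** * Probabilities and means of bounded variables *)

Definition pr d (T : measurableType d) (R : realType) (P : probability T R)
  (A : set T) : R := fine (P A).

(** All losses and counts below are in this class, which is closed under sums,
products and indicators, and on which [mean] is linear and monotone. *)
Definition bounded_measurable d (T : measurableType d) (R : realType)
    (f : T -> R) : Prop :=
  measurable_fun setT f /\ exists M, forall x, `|f x| <= M.

Section toolkit.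
Context d (T : measurableType d) (R : realType) (P : probability T R).
Implicit Types (A B : set T) (f g : T -> R).
Local Notation pr := (pr P).
Local Notation bm := (@bounded_measurable d T R).

Lemma prE A : measurable A -> (pr A)%:E = P A.
Proof. by move=> mA; rewrite /pr fineK// fin_num_measure. Qed.

Lemma pr_ge0 A : 0 <= pr A.
Proof. by rewrite /pr fine_ge0. Qed.

Lemma pr_le A B : measurable A -> measurable B -> A `<=` B -> pr A <= pr B.
Proof. by move=> mA mB AB; rewrite -lee_fin !prE// le_measure ?inE. Qed.

Lemma prC A : measurable A -> pr (~` A) = 1 - pr A.
Proof.
move=> mA; apply: EFin_inj; rewrite EFinB !prE//; last exact: measurableC.
by rewrite probability_setC.
Qed.

Lemma prU A B : measurable A -> measurable B -> pr (A `|` B) <= pr A + pr B.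
Proof.
move=> mA mB; rewrite -lee_fin EFinD !prE//; last exact: measurableU.
exact: measureU2.
Qed.

Lemma bm_cst (c : R) : bm (cst c).
Proof. by split; [exact: measurable_cst|exists `|c|]. Qed.

Lemma bmD f g : bm f -> bm g -> bm (fun x => f x + g x).
Proof.
move=> [mf [M fM]] [mg [M' gM]]; split; first exact: measurable_funD.
exists (M + M') => x; rewrite (le_trans (ler_normD _ _))//.
by have := fM x; have := gM x; lra.
Qed.

Lemma bmM f g : bm f -> bm g -> bm (fun x => f x * g x).
Proof.
move=> [mf [M fM]] [mg [M' gM]]; split; first exact: measurable_funM.
by exists (M * M') => x; rewrite normrM ler_pM.
Qed.

Lemma bmZ (c : R) f : bm f -> bm (fun x => c * f x).
Proof. by move=> bf; apply: bmM => //; exact: bm_cst. Qed.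

Lemma bm_ind A : measurable A -> bm \1_A.
Proof.
move=> mA; split; first exact: measurable_indic.
by exists 1 => x; rewrite indicE; case: (x \in A); rewrite ?normr0 ?normr1.
Qed.

Lemma bm_sum (I : Type) (r : seq I) (Q : pred I) (F : I -> T -> R) :
  (forall i, Q i -> bm (F i)) -> bm (fun x => \sum_(i <- r | Q i) F i x).
Proof.
move=> bF; elim: r => [|i r IH].
  have -> : (fun x => \sum_(i <- [::] | Q i) F i x) = cst 0.
    by apply/funext => t; rewrite big_nil.
  exact: bm_cst.
have -> : (fun x => \sum_(j <- i :: r | Q j) F j x) =
  (fun x => (if Q i then F i x else 0) + \sum_(j <- r | Q j) F j x).
  by apply/funext => t; rewrite big_cons; case: (Q i) => //; rewrite add0r.
by apply: bmD => //; case: (boolP (Q i)) => [/bF//|_]; exact: bm_cst.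
Qed.

Lemma bm_integrable f : bm f -> P.-integrable setT (EFin \o f).
Proof.
move=> [mf [M fM]]; apply: measurable_bounded_integrable => //.
  exact: (le_lt_trans (@probability_le1 _ _ _ P _ measurableT) (ltry _)).
exists M; split; first exact: num_real.
by move=> x Mx t _; exact: le_trans (fM t) (ltW Mx).
Qed.

Definition mean f : R := \int[P]_x f x.

Lemma E_mean f : bm f -> 'E_P[f]%E = (mean f)%:E.
Proof.
move=> bf; rewrite unlock /mean /Rintegral fineK//.
by apply: integrable_fin_num => //; exact: bm_integrable.
Qed.

Lemma meanD f g : bm f -> bm g -> mean (fun x => f x + g x) = mean f + mean g.
Proof. by move=> bf bg; apply: RintegralD => //; exact: bm_integrable. Qed.

Lemma meanZ c f : bm f -> mean (fun x => c * f x) = c * mean f.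
Proof. by move=> bf; apply: RintegralZl => //; exact: bm_integrable. Qed.

Lemma mean_ind A : measurable A -> mean \1_A = pr A.
Proof. by move=> mA; rewrite /mean /Rintegral integral_indic// setIT. Qed.

Lemma mean_cst c : mean (cst c) = c.
Proof.
by rewrite /mean Rintegral_cst// [X in fine X](_ : _ = 1%E) ?mulr1//; exact: probability_setT.
Qed.

Lemma mean_le f g : bm f -> bm g -> (forall x, f x <= g x) -> mean f <= mean g.
Proof. by move=> bf bg fg; apply: le_Rintegral => //; exact: bm_integrable. Qed.

Lemma mean_sum (I : Type) (r : seq I) (Q : pred I) (F : I -> T -> R) :
  (forall i, Q i -> bm (F i)) ->
  mean (fun x => \sum_(i <- r | Q i) F i x) = \sum_(i <- r | Q i) mean (F i).
Proof.
move=> bF; elim: r => [|i r IH].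
  rewrite big_nil -[RHS](mean_cst 0); congr mean.
  by apply/funext => t; rewrite big_nil.
rewrite big_cons -IH; case: ifPn => [Qi|nQi].
  rewrite -meanD//; [|exact: bF|exact: bm_sum].
  by congr mean; apply/funext => x; rewrite big_cons Qi.
by congr mean; apply/funext => x; rewrite big_cons (negbTE nQi).
Qed.

Lemma measurable_set_lt f g : measurable_fun setT f -> measurable_fun setT g ->
  measurable [set x | f x < g x].
Proof.
move=> mf mg; have := @measurable_fun_ltr _ _ _ setT _ _ mf mg.
by move=> /(_ measurableT [set true] ltac:(by [])); rewrite setTI.
Qed.

Lemma measurable_set_le f g : measurable_fun setT f -> measurable_fun setT g ->
  measurable [set x | f x <= g x].
Proof.
move=> mf mg; have := @measurable_fun_ler _ _ _ setT _ _ mf mg.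
by move=> /(_ measurableT [set true] ltac:(by [])); rewrite setTI.
Qed.

(** Pairwise independence bounds the variance of the count by its mean M, and a
count below M / 2 deviates from the mean by M / 2. *)
Lemma count_lower_tail (I : finType) (J : {set I}) (A : I -> set T) (p : R) :
  (forall i, measurable (A i)) ->
  (forall i, i \in J -> pr (A i) = p) ->
  (forall i j, i \in J -> j \in J -> i != j -> pr (A i `&` A j) = p * p) ->
  0 < #|J|%:R * p ->
  pr [set w | \sum_(i in J) \1_(A i) w < #|J|%:R * p / 2] <= 4 / (#|J|%:R * p).
Proof.
move=> mA pA pAA; set M := #|J|%:R * p => M0.
pose N w : R := \sum_(i in J) \1_(A i) w.
have bN : bm N by apply: bm_sum => i _; exact: bm_ind.
have mB : measurable [set w | N w < M / 2].
  by apply: measurable_set_lt => //; case: bN.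
have meanN : mean N = M.
  rewrite mean_sum; last by move=> i _; exact: bm_ind.
  under eq_bigr => i iJ do rewrite mean_ind// pA//.
  by rewrite sumr_const /M mulr_natl.
have meanN2 : mean (fun w => N w * N w) <= M + M * M.
  have -> : (fun w => N w * N w) =
      (fun w => \sum_(i in J) \sum_(j in J) \1_(A i `&` A j) w).
    apply/funext => w; rewrite /N big_distrl/=; apply: eq_bigr => i _.
    by rewrite big_distrr/=; apply: eq_bigr => j _; rewrite indicI.
  rewrite mean_sum; last first.
    by move=> i _; apply: bm_sum => j _; apply: bm_ind; exact: measurableI.
  have -> : M + M * M = \sum_(i in J) (p + M * p).
    by rewrite sumr_const -mulr_natl /M; ring.
  apply: ler_sum => i iJ.
  rewrite mean_sum; last by move=> j _; apply: bm_ind; exact: measurableI.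
  rewrite (bigD1 i)//= mean_ind; last exact: measurableI.
  have p0 : 0 <= p by rewrite -(pA i iJ) pr_ge0.
  rewrite setIid pA// lerD2l.
  apply: le_trans (_ : \sum_(j in J | j != i) p * p <= _).
    apply: ler_sum => j /andP[jJ ji]; rewrite mean_ind; last exact: measurableI.
    by rewrite pAA// eq_sym.
  rewrite /M -mulrA mulr_natl -sumr_const [leRHS](bigD1 i)//= lerDr.
  by rewrite mulr_ge0.
have key : mean (fun w => M ^+ 2 / 4 * \1_[set w | N w < M / 2] w + 2 * M * N w) <=
    mean (fun w => N w * N w + M ^+ 2).
  apply: mean_le.
  - by apply: bmD; apply: bmZ => //; exact: bm_ind.
  - by apply: bmD; [exact: bmM|exact: bm_cst].
  move=> w; rewrite indicE; case: (boolP (w \in _)) => [|_] /=; last first.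
    by rewrite mulr0; have := sqr_ge0 (N w - M); lra.
  rewrite inE/= mulr1 => NM.
  have : 0 <= (M / 2 - N w) * (M - N w + M / 2) by apply: mulr_ge0; lra.
  lra.
rewrite meanD in key; last 2 first.
- by apply: bmZ; exact: bm_ind.
- exact: bmZ.
rewrite meanD in key; last 2 first.
- exact: bmM.
- exact: bm_cst.
rewrite meanZ in key; last exact: bm_ind.
rewrite meanZ// mean_ind// meanN mean_cst in key.
rewrite ler_pdivlMr// -(ler_pM2r M0).
by rewrite -/(N _); nra.
Qed.
End toolkit.

(** * Independent Gaussian coordinates *)

Definition shift_coord (R : realType) n (theta : n.-tuple R) (i : 'I_n) (mu : R)
  : n.-tuple R := [tuple tnth theta k + (if k == i then mu else 0) | k < n].

Definition rect (R : realType) n (B : 'I_n -> set R) : set (n.-tuple R) :=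
  [set x | forall k, B k (tnth x k)].

Definition rects (R : realType) n : set (set (n.-tuple R)) :=
  [set A | exists2 B : 'I_n -> set R, (forall k, measurable (B k)) & A = rect B].

Lemma rect_bigcap (R : realType) n (B : 'I_n -> set R) :
  rect B = \bigcap_(i in [set` [set: 'I_n]%SET]) ((fun x => tnth x i) @^-1` B i).
Proof.
apply/seteqP; split => x /= Bx; first by move=> k _; exact: Bx.
by move=> k; apply: (Bx k); rewrite /= inE.
Qed.

Lemma measurable_bigcap_set d (T : measurableType d) (I : finType) (J : {set I})
    (F : I -> set T) : (forall i, measurable (F i)) ->
  measurable (\bigcap_(i in [set` J]) F i).
Proof.
by move=> mF; apply: fin_bigcap_measurable => //; exact: finite_finset.
Qed.

Lemma measurable_rect (R : realType) n (B : 'I_n -> set R) :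
  (forall k, measurable (B k)) -> measurable (rect B).
Proof.
move=> mB; rewrite rect_bigcap; apply: measurable_bigcap_set => i.
by rewrite -[X in measurable X]setTI; exact: measurable_tnth.
Qed.

Lemma measurable_tuple_rects (R : realType) n :
  @measurable _ (n.-tuple R) = <<s @rects R n >>.
Proof.
apply/seteqP; split; last first.
  apply: smallest_sub; first exact: sigma_algebra_measurable.
  by move=> _ [B mB ->]; exact: measurable_rect.
apply: sub_smallest2r; first exact: smallest_sigma_algebra.
move=> A; rewrite -bigcup_seq => -[i _ [C mC <-]].
exists (fun k => if k == i then C else setT); first by move=> k; case: ifP.
apply/seteqP; split => x /=.
  by move=> [_ Cx] k; case: eqP => // ->.
by move=> /(_ i); rewrite eqxx.
Qed.

Lemma rects_setI (R : realType) n : setI_closed (@rects R n).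
Proof.
move=> _ _ [B mB ->] [C mC ->]; exists (fun k => B k `&` C k).
  by move=> k; exact: measurableI.
apply/seteqP; split => x /=; first by move=> [Bx Cx] k; split.
by move=> BCx; split => k; case: (BCx k).
Qed.

Section iid.
Context d (T : measurableType d) (R : realType) (P : probability T R) (n : nat)
  (eps : 'I_n -> {RV P >-> R}).
Hypothesis iid : iid_std_normal eps.
Local Notation N := (@normal_prob R 0 1).
Local Notation pr := (pr P).

Lemma eps_law i (A : set R) : measurable A -> P (eps i @^-1` A) = N A.
Proof. by move=> mA; have [/(_ i A mA)] := iid. Qed.

Lemma measurable_eps i (A : set R) : measurable A -> measurable (eps i @^-1` A).
Proof. by move=> mA; rewrite -[X in measurable X]setTI; exact: measurable_funPT. Qed.

Lemma eps_indep2 i j (A B : set R) : measurable A -> measurable B -> i != j ->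
  pr (eps i @^-1` A `&` eps j @^-1` B) = pr (eps i @^-1` A) * pr (eps j @^-1` B).
Proof.
move=> mA mB ij.
have [_ /(_ [set i; j]%SET (fun k => if k == i then A else B))] := iid.
move=> /(_ ltac:(by move=> k; case: ifP)).
rewrite (big_setD1 i) ?set21//= eqxx (_ : ([set i; j] :\ i)%SET = [set j]%SET); last first.
  by apply/setP => k; rewrite !inE; case: eqVneq => //= ->; rewrite (negbTE ij).
rewrite big_set1 eq_sym (negbTE ij).
rewrite (_ : \bigcap_(k in _) _ = eps i @^-1` A `&` eps j @^-1` B).
  move=> H; apply: EFin_inj; rewrite EFinM !prE//; [exact: measurable_eps..|].
  by apply: measurableI; exact: measurable_eps.
apply/seteqP; split => w /=.
  move=> H; split; first by have := H i; rewrite /= eqxx; apply; exact: set21.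
  by have := H j; rewrite /= eq_sym (negbTE ij); apply; exact: set22.
move=> [Aw Bw] k /=; rewrite !inE => /orP[/eqP->|/eqP->]; first by rewrite eqxx.
by rewrite eq_sym (negbTE ij).
Qed.

Lemma measurable_observation (theta : n.-tuple R) :
  measurable_fun setT (observation eps theta).
Proof.
apply/measurable_fun_tnthP => i.
rewrite (_ : _ \o _ = (fun w => tnth theta i + eps i w)).
  by apply: measurable_funD => //; exact: measurable_funPT.
by apply/funext => w /=; rewrite tnth_mktuple.
Qed.

Lemma measurable_obs_preimage (theta : n.-tuple R) (A : set (n.-tuple R)) :
  measurable A -> measurable (observation eps theta @^-1` A).
Proof.
by move=> mA; rewrite -[X in measurable X]setTI; exact: measurable_observation.
Qed.

Section shift.
Variables (theta : n.-tuple R) (i : 'I_n) (mu : R).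
Local Notation theta' := (shift_coord theta i mu).
Let lr w : R := expR (mu * eps i w - mu ^+ 2 / 2).

Let mlr : measurable_fun setT lr.
Proof.
apply: measurableT_comp => //; apply: measurable_funB => //.
by apply: measurable_funM => //; exact: measurable_funPT.
Qed.

Let mweight : measurable_fun setT (fun x : R => expR (mu * x - mu ^+ 2 / 2)).
Proof.
apply: measurableT_comp => //; apply: measurable_funB => //.
Qed.

(** One coordinate can be integrated on its own on an event [E] that is
independent of it. *)
Let lr_slice (B : set R) (E : set T) : measurable B -> measurable E ->
  (forall C, measurable C -> P (eps i @^-1` C `&` E) = (pr E)%:E * N C)%E ->
  (\int[P]_(w in eps i @^-1` B `&` E) (lr w)%:E =
   (pr E)%:E * N ((fun x => (x + mu)%R) @^-1` B))%E.
Proof.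
move=> mB mE ind.
have mBe := measurable_eps i mB.
rewrite integral_mkcondr.
have -> : (\int[P]_(w in eps i @^-1` B) ((EFin \o lr) \_ E) w =
    \int[P]_(w in eps i @^-1` B) ((EFin \o lr) w * (\1_E w)%:E))%E.
  by apply: eq_integral => w _; rewrite epatch_indic.
rewrite -(@integral_density _ _ _ P (mrestr P mE) \1_E)//; last 3 first.
- by move=> A mA; rewrite integral_indic// setIC.
- exact/measurable_EFinP/measurable_funTS.
- by move=> w; rewrite lee_fin expR_ge0.
have me : measurable_fun setT (eps i : T -> measurableTypeR R).
  by move=> _ A mA; rewrite setTI; exact: measurable_eps.
pose nu := measure_function_pushforward__canonical__measure_function_Measure (mrestr P mE) me.
have -> : (\int[mrestr P mE]_(w in eps i @^-1` B) (EFin \o lr) w =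
  \int[nu]_(x in B) (expR (mu * x - mu ^+ 2 / 2))%:E)%E.
  rewrite ge0_integral_pushforward//.
  exact/measurable_EFinP/measurable_funTS.
rewrite (@integral_density _ _ _ N nu (fun=> pr E))//; last 3 first.
- by move=> y; exact: pr_ge0.
- by move=> A mA; transitivity ((pr E)%:E * N A)%E; [exact: ind|rewrite -integral_cst].
- exact/measurable_EFinP/measurable_funTS.
transitivity ((\int[N]_(x in B) (expR (mu * x - mu ^+ 2 / 2))%:E) * (pr E)%:E)%E.
  apply: ge0_integralZr => //.
  - exact/measurable_EFinP/measurable_funTS.
  - by rewrite lee_fin pr_ge0.
by rewrite muleC normal_shift.
Qed.

Let shift_rect (A : set (n.-tuple R)) : rects A ->
  P (observation eps theta' @^-1` A) =
  (\int[P]_(w in observation eps theta @^-1` A) (lr w)%:E)%E.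
Proof.
move=> [B mB ->].
pose B' k := (fun x => x + tnth theta k) @^-1` B k.
have mB' k : measurable (B' k).
  rewrite -[X in measurable X]setTI; apply: measurable_funD => //.
pose E := \bigcap_(k in [set` (~: [set i])%SET]) (eps k @^-1` B' k).
have mE : measurable E by apply: measurable_bigcap_set => k; exact: measurable_eps.
have ind C : measurable C -> P (eps i @^-1` C `&` E) = ((pr E)%:E * N C)%E.
  move=> mC; rewrite prE//; have [_ indep] := iid.
  have := indep [set: 'I_n]%SET (fun k => if k == i then C else B' k).
  move=> /(_ ltac:(by move=> k; case: ifP)).
  rewrite (big_setD1 i) ?inE//= eqxx eps_law// muleC.
  rewrite (_ : \bigcap_(k in _) _ = eps i @^-1` C `&` E).
    move=> ->; congr (_ * _)%E; rewrite indep//.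
    by apply: eq_big => k; rewrite !inE ?andbT// => /negbTE ->.
  apply/seteqP; split => w /=.
    move=> H; split; first by have := H i; rewrite /= eqxx; apply; rewrite inE.
    by move=> k /=; rewrite !inE => /negbTE ki; have := H k; rewrite /= ki; apply; rewrite inE.
  move=> [Cw Ew] k _ /=; case: eqVneq => [->//|ki].
  by apply: Ew; rewrite /= !inE.
have -> : observation eps theta @^-1` rect B = eps i @^-1` B' i `&` E.
  apply/seteqP; split => w /=.
    move=> H; split; first by have := H i; rewrite tnth_mktuple addrC.
    by move=> k _ /=; have := H k; rewrite tnth_mktuple addrC.
  move=> [Bw Ew] k; rewrite tnth_mktuple addrC.
  by case: (eqVneq k i) => [->//|ki]; apply: Ew; rewrite /= !inE.
rewrite lr_slice// -ind.
  congr (P _); apply/seteqP; split => w /=.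
    move=> H; split.
      by have := H i; rewrite !tnth_mktuple eqxx /B' /= addrC addrA addrAC.
    move=> k /=; rewrite !inE => /negbTE ki; have := H k.
    by rewrite !tnth_mktuple ki addr0 addrC.
  move=> [Bw Ew] k; rewrite !tnth_mktuple.
  case: (eqVneq k i) => [->//|ki]; last by rewrite addr0 addrC; apply: Ew; rewrite /= !inE.
  by rewrite addrC addrA addrAC.
rewrite -[X in measurable X]setTI; apply: measurable_funD => //.
Qed.

(** Both sides are finite measures of [A], so it is enough to compare them on
rectangles. There independence separates the coordinate i from the others, and
[normal_shift] applies to it. *)
Lemma shift_likelihood (A : set (n.-tuple R)) : measurable A ->
  P (observation eps theta' @^-1` A) =
  (\int[P]_(w in observation eps theta @^-1` A) (lr w)%:E)%E.
Proof.
rewrite measurable_tuple_rects.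
have mpre S : measurable S -> measurable_fun (observation eps theta @^-1` S) (EFin \o lr).
  by move=> mS; exact/measurable_EFinP/measurable_funTS.
have total : P (observation eps theta' @^-1` setT) =
    (\int[P]_(w in observation eps theta @^-1` setT) (lr w)%:E)%E.
  apply: shift_rect; exists (fun=> setT) => //.
  by apply/seteqP; split.
pose Q (S : set (n.-tuple R)) := P (observation eps theta' @^-1` S) =
  (\int[P]_(w in observation eps theta @^-1` S) (lr w)%:E)%E.
rewrite -/(Q A); move: A.
apply: (@dynkin_induction _ _ (@rects R n) Q) => //.
- exact: measurable_tuple_rects.
- exact: rects_setI.
- move=> S mS IH.
  have mS1 := measurable_obs_preimage theta mS.
  have tot := total; rewrite !preimage_setT probability_setT in tot.
  rewrite -(setvU (observation eps theta @^-1` S)) in tot.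
  rewrite ge0_integral_setU// in tot; last 4 first.
  + exact: measurableC.
  + by rewrite setvU; exact/measurable_EFinP/measurable_funTS.
  + by move=> w _; rewrite lee_fin expR_ge0.
  + by rewrite disj_set2E setICl.
  rewrite -IH in tot; rewrite /Q preimage_setC.
  rewrite probability_setC; last exact: measurable_obs_preimage.
  rewrite tot addeK// fin_num_measure//.
  exact: measurable_obs_preimage.
- move=> F mF tF IH; rewrite /Q !preimage_bigcup.
  have tF' t : trivIset setT (fun k => observation eps t @^-1` F k).
    by move=> k l _ _ [w [Fk Fl]]; apply: tF => //; exists (observation eps t w).
  rewrite measure_semi_bigcup//; last 2 first.
  + by move=> k; exact: measurable_obs_preimage.
  + by apply: bigcupT_measurable => k; exact: measurable_obs_preimage.
  rewrite ge0_integral_bigcup//; last 3 first.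
  + by move=> k; exact: measurable_obs_preimage.
  + exact/measurable_EFinP/measurable_funTS.
  + by move=> w _; rewrite lee_fin expR_ge0.
  by apply: eq_eseriesr => k _; exact: IH.
Qed.
End shift.
End iid.

(** * Order statistics and the step-down procedure *)

Lemma measurable_bool_tuple n (A : set (n.-tuple bool)) : measurable A.
Proof.
apply: countable_measurable => [t|]; last exact: countableP.
rewrite (_ : [set t] = \bigcap_(i in [set` [set: 'I_n]%SET])
    ((fun x : n.-tuple bool => tnth x i) @^-1` [set tnth t i])).
  apply: measurable_bigcap_set => i.
  by rewrite -[X in measurable X]setTI; exact: measurable_tnth.
apply/seteqP; split => x /=; first by move=> ->.
by move=> H; apply: eq_from_tnth => i; apply: H; rewrite /= inE.
Qed.

Lemma measurable_from_bool_tuple n d (U : measurableType d) (h : n.-tuple bool -> U) :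
  measurable_fun setT h.
Proof. by move=> _ B _; rewrite setTI; exact: measurable_bool_tuple. Qed.

Lemma bm_bool_tuple d (T : measurableType d) (R : realType) n
    (phi : T -> n.-tuple bool) (h : n.-tuple bool -> R) :
  measurable_fun setT phi -> bounded_measurable (fun w => h (phi w)).
Proof.
move=> mphi; split.
  by apply: (@measurableT_comp _ _ _ _ _ _ h _ phi) => //; exact: measurable_from_bool_tuple.
exists (\sum_t `|h t|) => w.
by rewrite (bigD1 (phi w))//= lerDl sumr_ge0.
Qed.

(** A decision rule that looks at the data only through finitely many measurable
tests is measurable. *)
Lemma measurable_bool_atoms d (T : measurableType d) (I : finType) n
    (f : I -> T -> bool) (h : (I -> bool) -> n.-tuple bool) :
  (forall g1 g2, g1 =1 g2 -> h g1 = h g2) ->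
  (forall k, measurable_fun setT (f k)) ->
  measurable_fun setT (fun x => h (f^~ x)).
Proof.
move=> hext mf.
pose V x : #|I|.-tuple bool := [tuple f (enum_val k) x | k < #|I|].
have mV : measurable_fun setT V.
  apply/measurable_fun_tnthP => k.
  rewrite (_ : _ \o _ = f (enum_val k)) //.
  by apply/funext => x /=; rewrite tnth_mktuple.
rewrite (_ : (fun x => _) = (fun t : #|I|.-tuple bool => h (fun i => tnth t (enum_rank i))) \o V).
  by apply: measurableT_comp => //; exact: measurable_from_bool_tuple.
by apply/funext => x /=; apply: hext => i; rewrite tnth_mktuple enum_rankK.
Qed.

Section gbs.
Context (R : realType) (n : nat) (alpha : R).
Implicit Types (X : n.-tuple R) (c : R).
Local Notation crit := (gbs_crit n alpha).
Local Notation Rn := (gbs_count alpha).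

Definition pcount X c : nat := #|[set i | p_value (tnth X i) <= c]%SET|.

Lemma size_sorted_p_values X : size (sorted_p_values X) = n.
Proof. by rewrite size_sort size_map size_tuple. Qed.

Lemma count_sorted_p_values X (a : pred R) :
  count a (sorted_p_values X) = #|[set i | a (p_value (tnth X i))]%SET|.
Proof.
rewrite (permP (permEl (perm_sort _ _))) /p_values -{1}(map_tnth_enum X).
rewrite -map_comp -sum1_count big_map big_enum_cond/= -sum1_card.
by apply: eq_bigl => i; rewrite inE.
Qed.

(** Turns conditions on order statistics into conditions on counts, which are
sums of indicators and can be estimated. *)
Lemma nth_sorted_p_values X j c : (j < n)%N ->
  (nth 0 (sorted_p_values X) j <= c) = (j < pcount X c)%N.
Proof.
move=> jn; rewrite /pcount -(count_sorted_p_values X (fun x => x <= c)).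
have srt : sorted <=%R (sorted_p_values X) by exact: sort_le_sorted.
case: ltnP => [jc|cj]; first exact: nth_count_le.
apply/negbTE; rewrite -ltNge; apply: nth_count_gt => //.
by rewrite cj size_sorted_p_values.
Qed.

Let valid X (r : nat) := [forall j : 'I_n, (j < r)%N ==>
  (nth 0 (sorted_p_values X) j <= crit j.+1)].

Let validP X r : (r <= n)%N ->
  reflect (forall j, (0 < j <= r)%N -> (j <= pcount X (crit j))%N) (valid X r).
Proof.
move=> rn; apply: (iffP forallP) => H => [[//|j] /= jr|j].
  have jn : (j < n)%N by exact: leq_trans jr rn.
  by have /implyP/(_ jr) := H (Ordinal jn); rewrite nth_sorted_p_values.
by apply/implyP => jr; rewrite nth_sorted_p_values//; exact: H.
Qed.

Lemma gbs_count_le X : (Rn X <= n)%N.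
Proof. by apply/bigmax_leqP => r _; rewrite -ltnS. Qed.

Lemma gbs_count_pcount X j : (0 < j <= Rn X)%N -> (j <= pcount X (crit j))%N.
Proof.
move: j; apply/validP; first exact: gbs_count_le.
rewrite /gbs_count; elim/big_ind: _ => //.
- by apply/forallP => j; rewrite ltn0.
- by move=> x y vx vy; rewrite /maxn; case: ifP.
Qed.

Lemma gbs_count_max X r : (r <= n)%N ->
  (forall j, (0 < j <= r)%N -> (j <= pcount X (crit j))%N) -> (r <= Rn X)%N.
Proof.
move=> rn /(validP _ rn) vr; have rn1 : (r < n.+1)%N by [].
exact: (@leq_bigmax_cond _ _ (fun r : 'I_n.+1 => r : nat) (Ordinal rn1)).
Qed.

(** The constraints up to rank [Rn X] hold, so by maximality it is the one at the
next rank that fails. *)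
Lemma gbs_count_next X : (Rn X < n)%N -> (pcount X (crit (Rn X).+1) <= Rn X)%N.
Proof.
move=> Rlt; rewrite leqNgt; apply/negP => H.
have := @gbs_count_max X (Rn X).+1 Rlt; rewrite ltnn => /(_ _)/negP; apply => //.
move=> j /andP[j0]; rewrite leq_eqVlt => /predU1P[->//|jR].
by apply: gbs_count_pcount; rewrite j0.
Qed.

Lemma gbs_rejectE X i :
  tnth (gbs alpha X) i = (p_value (tnth X i) \in take (Rn X) (sorted_p_values X)).
Proof. by rewrite tnth_mktuple. Qed.

Lemma gbs_reject X i c : p_value (tnth X i) <= c -> (pcount X c <= Rn X)%N ->
  tnth (gbs alpha X) i.
Proof.
move=> pc cR; rewrite gbs_rejectE; set p := p_value _ in pc *.
have ps : p \in sorted_p_values X.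
  by rewrite mem_sort; apply: map_f; exact: mem_tnth.
have kn : (index p (sorted_p_values X) < n)%N.
  by rewrite -[X in (_ < X)%N](size_sorted_p_values X) index_mem.
have := @nth_sorted_p_values X _ c kn; rewrite nth_index// pc => /esym kc.
by rewrite in_take// (leq_trans kc).
Qed.

Lemma gbs_reject_le X i : tnth (gbs alpha X) i ->
  (0 < Rn X)%N /\ p_value (tnth X i) <= crit (Rn X).
Proof.
rewrite gbs_rejectE => pt; have ps := mem_take pt.
move: pt; rewrite in_take// => kR; split; first exact: leq_ltn_trans kR.
have R0 : (0 < Rn X)%N by exact: leq_ltn_trans kR.
have kn := leq_trans kR (gbs_count_le X).
rewrite -[p_value _](nth_index 0 ps) nth_sorted_p_values//.
by apply: leq_trans kR _; apply: gbs_count_pcount; rewrite R0 leqnn.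
Qed.

Lemma gbs_reject_all X i : Rn X = n -> tnth (gbs alpha X) i.
Proof.
move=> RE; apply: (@gbs_reject X i (p_value (tnth X i))) => //.
by rewrite RE /pcount -[X in (_ <= X)%N](card_ord n) max_card.
Qed.

Lemma gbs_rejections X : (Rn X <= \sum_(i < n) tnth (gbs alpha X) i)%N.
Proof.
have -> : (\sum_(i < n) tnth (gbs alpha X) i)%N =
    count (mem (take (Rn X) (sorted_p_values X))) (sorted_p_values X).
  rewrite count_sorted_p_values -sum1_card [RHS]big_mkcond/=.
  by apply: eq_bigr => i _; rewrite gbs_rejectE inE; case: (_ \in take _ _).
rewrite -[X in count _ X](cat_take_drop (Rn X)) count_cat.
apply: leq_trans (leq_addr _ _).
rewrite (_ : count _ _ = size (take (Rn X) (sorted_p_values X))).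
  by rewrite size_take_min size_sorted_p_values leq_min leqnn gbs_count_le.
by apply/eqP; rewrite -all_count; apply/allP.
Qed.

Hypothesis alpha01 : 0 < alpha < 1.

Lemma gbs_crit_mono j k : (j <= k)%N -> (k <= n)%N -> crit j <= crit k.
Proof.
move=> jk kn; have /andP[a0 a1] := alpha01.
have den l : (l <= n)%N -> 0 < n%:R + 1 - l%:R * (1 - alpha).
  move=> ln; have : l%:R <= n%:R :> R by rewrite ler_nat.
  have : 0 <= l%:R * alpha by rewrite mulr_ge0// ltW.
  lra.
have jk' : j%:R <= k%:R :> R by rewrite ler_nat.
rewrite /gbs_crit ler_pM ?invr_ge0 ?mulr_ge0//; [exact: ltW|..|exact: ler_wpM2r (ltW a0) _ _ jk'|].
- by rewrite ltW// den// (leq_trans jk).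
rewrite lef_pV2 ?posrE ?den// ?(leq_trans jk)//.
by rewrite lerB// ler_wpM2r//; lra.
Qed.

Lemma gbs_crit_ge j : (j <= n)%N -> j%:R * alpha / (n%:R + 1) <= crit j.
Proof.
move=> jn; have /andP[a0 a1] := alpha01.
have jn' : j%:R <= n%:R :> R by rewrite ler_nat.
have j0 : 0 <= j%:R :> R by [].
rewrite /gbs_crit ler_wpM2l ?mulr_ge0//; first exact: ltW.
have H : 0 <= j%:R * (1 - alpha) by rewrite mulr_ge0//; lra.
have H2 : 0 <= j%:R * alpha by rewrite mulr_ge0//; lra.
by rewrite lef_pV2 ?posrE; lra.
Qed.

Lemma gbs_crit_le j : (j.*2 <= n)%N -> (0 < n)%N -> crit j <= 2 * j%:R * alpha / n%:R.
Proof.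
move=> jn n0; have /andP[a0 a1] := alpha01.
have n0' : 0 < n%:R :> R by rewrite ltr0n.
have jn' : 2 * j%:R <= n%:R :> R by rewrite mulr_natl -mulrnA muln2 ler_nat.
have j0 : 0 <= j%:R :> R by [].
have H2 : 0 <= j%:R * alpha by rewrite mulr_ge0//; lra.
have jle : j%:R * (1 - alpha) <= n%:R / 2 by lra.
rewrite /gbs_crit ler_pdivrMr; last by lra.
have -> : j%:R * alpha = 2 * j%:R * alpha / n%:R * (n%:R / 2).
  by field; rewrite lt0r_neq0.
apply: ler_wpM2l; last by lra.
by rewrite divr_ge0 ?mulr_ge0//; lra.
Qed.

Lemma measurable_p_value : measurable_fun setT (@p_value R : R -> R).
Proof.
apply: measurable_funM => //; apply: (@measurableT_comp _ _ _ _ _ _ (@Phibar R : R -> R)).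
  by apply: continuous_measurable_fun; exact: Phibar_continuous.
exact: normr_measurable.
Qed.

(** The comparisons of each p-value with each critical value determine GBS: i is
rejected when, for some rank r, the constraints hold up to r and P_i <= c_r. *)
Lemma measurable_gbs : measurable_fun setT (@gbs R n alpha).
Proof.
pose atom (k : 'I_n * 'I_n) X := p_value (tnth X k.1) <= crit k.2.+1.
pose h (g : 'I_n * 'I_n -> bool) : n.-tuple bool :=
  [tuple [exists r : 'I_n, [forall j : 'I_n, (j <= r)%N ==>
     (j < #|[set k | g (k, j)]%SET|)%N] && g (i, r)] | i < n].
rewrite (_ : @gbs R n alpha = fun X => h (atom^~ X)).
  apply: measurable_bool_atoms.
    move=> g1 g2 g12; apply: eq_from_tnth => i; rewrite !tnth_mktuple.
    apply: eq_existsb => r; congr (_ && _); last exact: g12.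
    apply: eq_forallb => j; congr (_ ==> (_ < _)%N).
    by apply: eq_card => k; rewrite !inE g12.
  move=> [i j]; apply: measurable_fun_ler => //.
  apply: (@measurableT_comp _ _ _ _ _ _ (@p_value R : R -> R)).
    exact: measurable_p_value.
  exact: measurable_tnth.
apply/funext => X; apply: eq_from_tnth => i; rewrite [RHS]tnth_mktuple.
apply/idP/existsP => [ri|[r /andP[/forallP vr ir]]].
  have [R0 pR] := gbs_reject_le ri; have Rle := gbs_count_le X.
  have rn : ((Rn X).-1 < n)%N by rewrite prednK.
  exists (Ordinal rn); rewrite /atom/= prednK// pR andbT.
  apply/forallP => j; apply/implyP => jR; apply: gbs_count_pcount.
  by rewrite /= -(prednK R0) ltnS.
have rR : (r < Rn X)%N.
  apply: gbs_count_max => // -[//|j] /= jr.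
  have jn : (j < n)%N by exact: leq_trans jr (ltn_ord r).
  by have /implyP := vr (Ordinal jn); apply.
move: ir; rewrite /atom/= => ir.
have {}ir : p_value (tnth X i) <= crit (Rn X).
  by apply: le_trans ir _; apply: gbs_crit_mono => //; exact: gbs_count_le.
have := gbs_count_le X; rewrite leq_eqVlt => /predU1P[/gbs_reject_all //|Rlt].
apply: (gbs_reject (c := crit (Rn X).+1)); last exact: gbs_count_next.
by apply: le_trans ir _; exact: gbs_crit_mono.
Qed.
End gbs.

(** * Finite-sample bound on the risk of the step-down procedure *)

Definition loss (R : realType) n s (theta : n.-tuple R) (phi : n.-tuple bool) : R :=
  FDP theta phi + FNP s theta phi.

Section loss_facts.
Context (R : realType) (n s : nat).
Implicit Types (theta : n.-tuple R) (phi : n.-tuple bool).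

Lemma FDP_ge0 theta phi : 0 <= FDP theta phi.
Proof. by rewrite divr_ge0. Qed.

Lemma FNP_ge0 theta phi : 0 <= FNP s theta phi.
Proof. by rewrite divr_ge0. Qed.

Lemma loss_ge0 theta phi : 0 <= loss s theta phi.
Proof. by rewrite addr_ge0 ?FDP_ge0 ?FNP_ge0. Qed.

Lemma FDP_le1 theta phi : FDP theta phi <= 1.
Proof.
rewrite /FDP ler_pdivrMr ?mul1r ?ltr0n ?leq_max// ler_nat leq_max; apply/orP; right.
by rewrite /false_rejections [leqRHS](bigID (fun i => tnth theta i == 0))/= leq_addr.
Qed.

Lemma missed_signalsE theta phi :
  missed_signals theta phi = (\sum_(i in signals theta) ~~ tnth phi i)%N.
Proof.
rewrite /missed_signals; apply: eq_big => i; first by rewrite inE.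
by move=> _; case: (tnth phi i).
Qed.

Lemma false_rejectionsE theta phi :
  false_rejections theta phi = (\sum_(i | i \notin signals theta) tnth phi i)%N.
Proof. by apply: eq_bigl => i; rewrite inE negbK. Qed.

Lemma FNPE theta phi : (0 < s)%N ->
  FNP s theta phi = (\sum_(i in signals theta) (~~ tnth phi i)%:R) / s%:R.
Proof.
move=> s0; rewrite /FNP missed_signalsE natr_sum.
by rewrite (maxn_idPr _).
Qed.

Lemma FNP_le1 theta phi : (0 < s)%N -> #|signals theta| = s -> FNP s theta phi <= 1.
Proof.
move=> s0 sE; rewrite FNPE// ler_pdivrMr ?ltr0n// mul1r.
apply: le_trans (_ : \sum_(i in signals theta) 1 <= _).
  by apply: ler_sum => i _; case: (tnth phi i).
by rewrite sumr_const sE.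
Qed.

Lemma loss_le2 theta phi : (0 < s)%N -> #|signals theta| = s -> loss s theta phi <= 2.
Proof.
move=> s0 sE; rewrite /loss.
by have := FDP_le1 theta phi; have := FNP_le1 phi s0 sE; lra.
Qed.
End loss_facts.

Lemma eq_ler (R : realType) (x y : R) : x = y -> x <= y.
Proof. by move=> ->. Qed.

Lemma dyadic_count_contradiction (R : realType) (a MK K Nz pc r : R) :
  a / 2 <= Nz -> Nz <= pc -> pc <= r -> r < 2 * K -> 4 * K <= MK -> MK <= a -> False.
Proof. lra. Qed.

Lemma geometric_half_sum (R : realType) n :
  \sum_(k < n) ((2 ^ k)%:R : R)^-1 <= 2.
Proof.
suff -> : \sum_(k < n) ((2 ^ k)%:R : R)^-1 = 2 - 2 / (2 ^ n)%:R.
  by rewrite gerBl divr_ge0.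
elim: n => [|n IH]; first by rewrite big_ord0 expn0; lra.
rewrite big_ord_recr/= IH expnS natrM; field.
by rewrite pnatr_eq0 expn_eq0.
Qed.

Section upper.
Context d (T : measurableType d) (R : realType) (P : probability T R) (n : nat)
  (eps : 'I_n -> {RV P >-> R}).
Hypothesis iid : iid_std_normal eps.
Local Notation pr := (pr P).

Lemma pr_eps_ge i z : pr (eps i @^-1` `[z, +oo[) = Phibar z.
Proof.
apply: EFin_inj; rewrite prE; last exact: measurable_eps.
by rewrite (eps_law iid)// Phibar_closed.
Qed.

Lemma pr_eps_le i z : pr (eps i @^-1` `]-oo, z]) = Phi z.
Proof.
apply: EFin_inj; rewrite prE; last exact: measurable_eps.
by rewrite (eps_law iid)// Phi_EFin.
Qed.

Lemma measurable_p_value_le c : measurable [set x : R | p_value x <= c].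
Proof.
by apply: measurable_set_le => //; exact: measurable_p_value.
Qed.

(** The p-value of x is at most c only if |x| is beyond the two-sided quantile of
level c. *)
Lemma pr_null_p_value i c : 0 < c <= 1 -> pr (eps i @^-1` [set x | p_value x <= c]) <= c.
Proof.
move=> c01; have [z z0 zc] := Phibar_quantile c01.
rewrite [leRHS](_ : c = Phi (- z) + Phibar z); last by rewrite PhiN; lra.
rewrite -(pr_eps_le i) -(pr_eps_ge i).
apply: le_trans (prU _ _ _); [|exact: measurable_eps..].
apply: pr_le.
- by apply: measurable_eps; exact: measurable_p_value_le.
- by apply: measurableU; exact: measurable_eps.
move=> w /=; rewrite !in_itv/= andbT /p_value -zc ler_pM2l// => zw.
have : z <= `|eps i w|.
  by rewrite leNgt; apply/negP => /(Phibar_lt (normr_ge0 _)); lra.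
by rewrite ler_normr => /orP[|]; [right|left; lra].
Qed.

Variables (theta : n.-tuple R) (s : nat) (alpha mu t : R).
Hypotheses (sE : #|signals theta| = s) (s0 : (0 < s)%N) (s4 : (4 * s <= n)%N)
  (alpha01 : 0 < alpha < 1) (mu0 : 0 <= mu) (t0 : 0 <= t)
  (beta_min : forall i, i \in signals theta -> mu <= `|tnth theta i|).
Let S := signals theta.
Let rho := Phibar (t - mu).
(** The expected number of signals with a p-value below crit j, relative to j, is
at least M as long as crit j < 2 Phibar t. *)
Let M := s%:R * rho * alpha / ((n%:R + 1) * (2 * Phibar t)).
Hypothesis M4 : 4 <= M.
Local Notation crit := (gbs_crit n alpha).
Let X w := observation eps theta w.

(** Deviations of the noise in the direction of the signal: they push the
observation beyond z whatever the amplitude, with the same probability for all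
signals. *)
Let side i z : set R :=
  if 0 < tnth theta i then `[z - mu, +oo[%classic else `]-oo, - (z - mu)]%classic.
Let A z i := eps i @^-1` side i z.

Let mside i z : measurable (side i z).
Proof. by rewrite /side; case: ifP. Qed.

Let mA z i : measurable (A z i).
Proof. exact: measurable_eps. Qed.

Let prA z i : pr (A z i) = Phibar (z - mu).
Proof.
by rewrite /A /side; case: ifP => _; rewrite ?pr_eps_ge// pr_eps_le -PhibarN opprK.
Qed.

Let prAA z i j : i != j -> pr (A z i `&` A z j) = Phibar (z - mu) * Phibar (z - mu).
Proof. by move=> ij; rewrite (eps_indep2 iid)// !prA. Qed.

Let A_p_value z i w : i \in S -> A z i w -> p_value (tnth (X w) i) <= 2 * Phibar z.
Proof.
move=> iS Aw; rewrite /p_value ler_pM2l//; apply: Phibar_noninc.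
have mui := beta_min iS.
rewrite tnth_mktuple; move: Aw; rewrite /A /side /=.
case: ltP => [th0|th0]; rewrite /= in_itv/= ?andbT => H.
  rewrite gtr0_norm// in mui.
  by apply: le_trans (ler_norm _); lra.
rewrite ler0_norm// in mui.
by apply: le_trans (_ : - (tnth theta i + eps i w) <= _); [lra|rewrite -normrN ler_norm].
Qed.

Let N z w : R := \sum_(i in S) \1_(A z i) w.

Let N_pcount z w c : 2 * Phibar z <= c -> N z w <= (pcount (X w) c)%:R.
Proof.
move=> zc; rewrite /N /pcount -sum1_card natr_sum.
rewrite [leRHS]big_mkcond [leLHS]big_mkcond/=; apply: ler_sum => i _.
case: (boolP (i \in S)) => iS; last by case: ifP.
rewrite indicE; case: (boolP (w \in _)) => [|_]; last by case: ifP.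
by rewrite inE => /(A_p_value iS) pw; rewrite inE (le_trans pw zc).
Qed.

Let n0 : (0 < n)%N.
Proof. by apply: leq_trans s4; rewrite muln_gt0. Qed.

Let rho0 : 0 < rho. Proof. exact: Phibar_gt0. Qed.

Let M0 : 0 < M. Proof. by apply: lt_le_trans M4. Qed.

Let small k := ((2 ^ k <= n)%N && (crit (2 ^ k) < 2 * Phibar t)).

(** The power at level t is rho; [Phibar_shift_ratio] transfers it to the higher
level whose two-sided p-value is crit (2 ^ k), at the price of the ratio of the
two p-values. *)
Let quantiles : exists z : nat -> R, forall k, small k ->
  2 * Phibar (z k) = crit (2 ^ k) /\ M * (2 ^ k)%:R <= s%:R * Phibar (z k - mu).
Proof.
suff /choice[z zP] : forall k, exists z, small k ->
    2 * Phibar z = crit (2 ^ k) /\ M * (2 ^ k)%:R <= s%:R * Phibar (z - mu).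
  by exists z.
move=> k.
have [/andP[kn kc]|] := boolP (small k); last by exists 0.
have a0 : 0 < alpha by case/andP: alpha01.
have ge := gbs_crit_ge alpha01 kn.
have n1 : 0 < n%:R + 1 :> R by rewrite ltr_wpDl.
have c0 : 0 < crit (2 ^ k).
  by apply: lt_le_trans ge; rewrite divr_gt0// mulr_gt0// ltr0n expn_gt0.
have [|z z0 zE] := @Phibar_quantile R (crit (2 ^ k)).
  rewrite c0/=; apply: (le_trans (ltW kc)).
  by have := Phibar_noninc t0; rewrite Phibar0; lra.
exists z => _; split => //.
have tz : t <= z.
  by rewrite leNgt; apply/negP => /ltW/Phibar_noninc; lra.
have ratio := Phibar_shift_ratio mu0 tz; rewrite -/rho in ratio.
have Pt := Phibar_gt0 t.
have -> : M * (2 ^ k)%:R = s%:R * (rho * ((2 ^ k)%:R * alpha / (n%:R + 1) / 2) / Phibar t).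
  by rewrite /M; field; rewrite !lt0r_neq0.
rewrite ler_wpM2l// ler_pdivrMr//; apply: le_trans ratio.
by rewrite ler_pM2l//; lra.
Qed.

Let nulls := (~: S)%SET.
Let C i := eps i @^-1` [set x | p_value x <= crit (2 * s)].
Let V w : R := \sum_(i in nulls) \1_(C i) w.

Let mC i : measurable (C i).
Proof. by apply: measurable_eps; exact: measurable_p_value_le. Qed.

Let crit2s : crit (2 * s) <= 4 * s%:R * alpha / n%:R.
Proof.
have s4' : ((2 * s).*2 <= n)%N by rewrite -muln2 mulnAC.
apply: le_trans (gbs_crit_le alpha01 s4' n0) _.
by rewrite natrM; apply: eq_ler; ring.
Qed.

Let s2n : (2 * s <= n)%N.
Proof. by apply: leq_trans s4; rewrite leq_mul2r orbT. Qed.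

Let pr_C i : pr (C i) <= 4 * s%:R * alpha / n%:R.
Proof.
apply: le_trans (pr_null_p_value _ _) crit2s; apply/andP; split.
  have [a0 a1] := andP alpha01.
  apply: lt_le_trans (gbs_crit_ge alpha01 s2n).
  by rewrite divr_gt0 ?mulr_gt0 ?ltr0n ?muln_gt0 ?s0 ?ltr_wpDl.
apply: le_trans crit2s _; rewrite ler_pdivrMr ?ltr0n// mul1r.
have [a0 a1] := andP alpha01.
have : 4 * s%:R <= n%:R :> R by rewrite -natrM ler_nat.
have : 0 <= s%:R :> R by [].
nra.
Qed.

Let meanV : mean P V <= 4 * s%:R * alpha.
Proof.
rewrite mean_sum; last by move=> i _; exact: bm_ind.
have [a0 a1] := andP alpha01.
have nn : 0 < n%:R :> R by rewrite ltr0n.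
apply: le_trans (_ : \sum_(i in nulls) (4 * s%:R * alpha / n%:R) <= _).
  by apply: ler_sum => i _; rewrite mean_ind//; exact: pr_C.
rewrite sumr_const -[leLHS]mulr_natl.
apply: le_trans (_ : n%:R * (4 * s%:R * alpha / n%:R) <= _).
  rewrite ler_wpM2r//; first by rewrite divr_ge0 ?mulr_ge0// ltW.
  by rewrite ler_nat -[leqRHS]card_ord max_card.
by apply: eq_ler; field; rewrite lt0r_neq0.
Qed.

Section pointwise.
Variables (z : nat -> R).
Hypothesis zP : forall k, small k ->
  2 * Phibar (z k) = crit (2 ^ k) /\ M * (2 ^ k)%:R <= s%:R * Phibar (z k - mu).
Variable w : T.
Hypothesis good : forall k, (k < n)%N -> small k ->
  s%:R * Phibar (z k - mu) / 2 <= N (z k) w.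
Local Notation Rn := (gbs_count alpha (X w)).
Local Notation phi := (gbs alpha (X w)).

(** If the step-down stopped before 2 Phibar t, at a rank [Rn] with
2 ^ k <= Rn + 1 < 2 ^ (k + 1), the control at the dyadic rank 2 ^ k would give
at least 2 ^ (k + 1) p-values below crit (Rn + 1), more than [Rn]. *)
Let next_crit : (Rn < n)%N -> 2 * Phibar t <= crit Rn.+1.
Proof.
move=> Rlt; rewrite leNgt; apply/negP => ct.
pose k := trunc_log 2 Rn.+1.
have /andP[kR Rk] := @trunc_log_bounds 2 Rn.+1 isT isT.
rewrite -/k in kR Rk.
have kc : crit (2 ^ k) <= crit Rn.+1 by exact: gbs_crit_mono.
have smk : small k by rewrite /small (leq_trans kR Rlt) (le_lt_trans kc ct).
have kn : (k < n)%N by apply: leq_trans (leq_trans kR Rlt); exact: ltn_expl.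
have [zE zM] := zP smk.
have Npc : N (z k) w <= (pcount (X w) (crit Rn.+1))%:R.
  by apply: N_pcount; rewrite zE.
apply: (@dyadic_count_contradiction R _ _ (2 ^ k)%:R _ _ Rn%:R (good kn smk) Npc _ _ _ zM).
- by rewrite ler_nat gbs_count_next.
- by rewrite -natrM ltr_nat -expnS; apply: leq_trans Rk.
- by rewrite ler_wpM2r.
Qed.

Let reject_strong i : i \in S -> A t i w -> tnth phi i.
Proof.
move=> iS Aw; have := gbs_count_le alpha (X w).
rewrite leq_eqVlt => /predU1P[/gbs_reject_all //|Rlt].
apply: (gbs_reject (c := crit Rn.+1)); last exact: gbs_count_next.
by apply: le_trans (A_p_value iS Aw) _; exact: next_crit.
Qed.

Let N_le_count : N t w <= Rn%:R.
Proof.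
have := gbs_count_le alpha (X w); rewrite leq_eqVlt => /predU1P[->|Rlt].
  apply: le_trans (N_pcount w (lexx _)) _.
  by rewrite ler_nat -[leqRHS]card_ord max_card.
by apply: le_trans (N_pcount w (next_crit Rlt)) _; rewrite ler_nat gbs_count_next.
Qed.

Let null_p_value i : i \in nulls -> tnth (X w) i = eps i w.
Proof. by rewrite !inE negbK => /eqP th0; rewrite tnth_mktuple th0 add0r. Qed.

Let FNP_good : FNP s theta phi <= \sum_(i in S) s%:R^-1 * \1_(~` A t i) w.
Proof.
rewrite FNPE// mulr_suml; apply: ler_sum => i iS.
rewrite mulrC ler_pM2l ?invr_gt0 ?ltr0n// indicE.
case: (boolP (tnth phi i)) => //= ni; rewrite mem_set//= => Aw.
by rewrite (reject_strong iS Aw) in ni.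
Qed.

(** If rank 2 s is reached, at least 2 s p-values are below crit (2 s), and s of
them are null, so that V >= s. Otherwise every false rejection is counted by
[V], and there are at least N t rejections. *)
Let FDP_good : FDP theta phi <= \1_[set w | N t w < s%:R * rho / 2] w + V w / s%:R
  + 2 * V w / (s%:R * rho).
Proof.
have s0' : 0 < s%:R :> R by rewrite ltr0n.
have V0 : 0 <= V w by apply: sumr_ge0 => i _; rewrite indicE.
have Vs : 0 <= V w / s%:R by rewrite divr_ge0.
have Vr : 0 <= 2 * V w / (s%:R * rho) by rewrite divr_ge0 ?mulr_ge0// ltW.
have F1 := FDP_le1 theta phi.
rewrite indicE; case: (boolP (w \in _)) => [_/=|]; first by lra.
rewrite notin_setE/= => /negP; rewrite -leNgt => Nw; rewrite add0r.
have [R2|R2] := leqP (2 * s) Rn.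
  suff : 1 <= V w / s%:R by lra.
  rewrite ler_pdivlMr// mul1r.
  have : (2 * s <= pcount (X w) (crit (2 * s)))%N.
    by apply: gbs_count_pcount; rewrite muln_gt0 s0 R2.
  rewrite -(ler_nat R) natrM => H.
  suff : (pcount (X w) (crit (2 * s)))%:R <= s%:R + V w by lra.
  rewrite /pcount -sum1_card natr_sum big_mkcond/= (bigID (mem S))/=.
  apply: lerD.
    apply: le_trans (_ : \sum_(i in S) 1 <= _); last by rewrite sumr_const sE.
    by apply: ler_sum => i _; case: ifP.
  rewrite /V (eq_bigl (mem nulls)); last by move=> i; rewrite !inE.
  apply: ler_sum => i inul; rewrite inE null_p_value// indicE.
  by case: ifPn => // pi; rewrite mem_set.
apply: le_trans (_ : 2 * V w / (s%:R * rho) <= _); last by lra.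
rewrite /FDP ler_pdivrMr; last by rewrite ltr0n leq_max.
have fr : (false_rejections theta phi)%:R <= V w.
  rewrite false_rejectionsE natr_sum /V (eq_bigl (mem nulls)); last by move=> i; rewrite !inE.
  apply: ler_sum => i inul; case: (boolP (tnth phi i)) => // ri.
  have [_ pR] := gbs_reject_le ri; rewrite null_p_value// in pR.
  rewrite indicE mem_set//=; apply: (le_trans pR); apply: gbs_crit_mono => //.
  exact: ltnW.
apply: (le_trans fr).
have rej : s%:R * rho / 2 <= (maxn 1 (\sum_(i < n) tnth phi i))%:R.
  apply: (le_trans Nw); apply: (le_trans N_le_count).
  by rewrite ler_nat leq_max gbs_rejections orbT.
apply: le_trans (ler_wpM2l Vr rej).
by apply: eq_ler; field; rewrite !lt0r_neq0.
Qed.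

Lemma loss_good : loss s theta phi <=
  \sum_(i in S) s%:R^-1 * \1_(~` A t i) w + \1_[set w | N t w < s%:R * rho / 2] w
  + V w / s%:R + 2 * V w / (s%:R * rho).
Proof. by rewrite /loss; have := FNP_good; have := FDP_good; lra. Qed.
End pointwise.

(** Outside the bad events no signal pushed above t by its noise is missed, and
1 - rho is the probability that the noise fails to do so; 16 / M pays for the dyadic
ranks at which too few signals are strong, the loss being at most 2; 4 / (s rho)
pays for having too few signals above t; the last two terms come from the nulls
below crit (2 s), of which 4 s alpha are expected at most. *)
Lemma gbs_risk_bound : (risk eps s (gbs alpha) theta <=
  (1 - rho + 16 / M + 4 / (s%:R * rho) + 4 * alpha + 8 * alpha / rho)%:E)%E.
Proof.
have [z zP] := quantiles.
have s0' : 0 < s%:R :> R by rewrite ltr0n.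
have bN y : bounded_measurable (N y) by apply: bm_sum => i _; exact: bm_ind.
have bV : bounded_measurable V by apply: bm_sum => i _; exact: bm_ind.
have mN (c y : R) : measurable [set w | N y w < c].
  by apply: measurable_set_lt => //; case: (bN y).
pose bad (k : 'I_n) := if small k then
  [set w | N (z k) w < s%:R * Phibar (z k - mu) / 2] else set0.
have mbad k : measurable (bad k) by rewrite /bad; case: ifP.
have tailN y : 0 < s%:R * Phibar (y - mu) ->
    pr [set w | N y w < s%:R * Phibar (y - mu) / 2] <= 4 / (s%:R * Phibar (y - mu)).
  move=> pos; rewrite -sE in pos *; apply: count_lower_tail => //.
  by move=> i j _ _; exact: prAA.
have prbad k : pr (bad k) <= 4 / M * ((2 ^ k)%:R : R)^-1.
  have K0 : 0 < (2 ^ k)%:R :> R by rewrite ltr0n expn_gt0.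
  rewrite /bad; case: ifPn => [/zP[_ zM]|_]; last first.
    by rewrite /pr measure0/= mulr_ge0 ?invr_ge0// divr_ge0// ltW.
  have MK : 0 < M * (2 ^ k)%:R by rewrite mulr_gt0.
  apply: le_trans (tailN _ _) _; first exact: lt_le_trans zM.
  by rewrite -mulrA -invfM ler_pM2l// lef_pV2 ?posrE// (lt_le_trans MK).
pose bound w : R := \sum_(i in S) s%:R^-1 * \1_(~` A t i) w
  + \1_[set w | N t w < s%:R * rho / 2] w
  + (s%:R^-1 + 2 / (s%:R * rho)) * V w + \sum_(k < n) 2 * \1_(bad k) w.
have bA i : bounded_measurable (fun w => s%:R^-1 * \1_(~` A t i) w : R).
  by apply: bmZ; apply: bm_ind; exact: measurableC.
have bbad k : bounded_measurable (fun w => 2 * \1_(bad k) w : R).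
  by apply: bmZ; exact: bm_ind.
have b1 : bounded_measurable (fun w => \sum_(i in S) s%:R^-1 * \1_(~` A t i) w : R).
  by apply: bm_sum => i _; exact: bA.
have b2 : bounded_measurable (\1_[set w | N t w < s%:R * rho / 2] : T -> R).
  by apply: bm_ind; exact: mN.
have b3 : bounded_measurable (fun w => (s%:R^-1 + 2 / (s%:R * rho)) * V w).
  exact: bmZ.
have b4 : bounded_measurable (fun w => \sum_(k < n) 2 * \1_(bad k) w : R).
  by apply: bm_sum => k _; exact: bbad.
have b12 := bmD b1 b2; have b123 := bmD b12 b3.
have bbound : bounded_measurable bound by exact: bmD.
have bloss : bounded_measurable (fun w => loss s theta (gbs alpha (X w))).
  apply: (@bm_bool_tuple _ _ _ _ (fun w => gbs alpha (X w)) (loss s theta)).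
  apply: (@measurableT_comp _ _ _ _ _ _ (@gbs R n alpha)); first exact: measurable_gbs.
  exact: measurable_observation.
rewrite [risk _ _ _ _](E_mean P bloss) lee_fin.
apply: le_trans (_ : mean P bound <= _).
  apply: mean_le => // w; rewrite /bound.
  have V0 : 0 <= (s%:R^-1 + 2 / (s%:R * rho)) * V w.
    by rewrite mulr_ge0 ?addr_ge0 ?invr_ge0 ?divr_ge0 ?mulr_ge0 ?sumr_ge0// ltW.
  have A0 : 0 <= \sum_(i in S) s%:R^-1 * \1_(~` A t i) w :> R.
    by rewrite sumr_ge0// => i _; rewrite mulr_ge0 ?invr_ge0.
  have I0 : 0 <= \1_[set w | N t w < s%:R * rho / 2] w :> R by rewrite indicE.
  have [badw|nobad] := pselect (exists k, bad k w).
    have [k bk] := badw; apply: le_trans (loss_le2 _ s0 sE) _.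
    rewrite [X in _ <= _ + X](bigD1 k)//=.
    have -> : \1_(bad k) w = 1 :> R by rewrite indicE mem_set.
    rewrite mulr1.
    have : 0 <= \sum_(i < n | i != k) 2 * \1_(bad i) w :> R.
      by rewrite sumr_ge0// => i _; rewrite mulr_ge0.
    lra.
  have good k : (k < n)%N -> small k -> s%:R * Phibar (z k - mu) / 2 <= N (z k) w.
    move=> kn sk; rewrite leNgt; apply/negP => lt; apply: nobad.
    by exists (Ordinal kn); rewrite /bad /= sk.
  have := loss_good zP good.
  have : 0 <= \sum_(k < n) 2 * \1_(bad k) w :> R.
    by rewrite sumr_ge0// => i _; rewrite mulr_ge0.
  have -> : (s%:R^-1 + 2 / (s%:R * rho)) * V w = V w / s%:R + 2 * V w / (s%:R * rho).
    by field; rewrite !lt0r_neq0.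
  rewrite -/(X w); lra.
rewrite /bound meanD// meanD// meanD// meanZ// mean_ind//.
rewrite mean_sum; last by move=> i _; exact: bA.
have -> : mean P (fun w => \sum_(k < n) 2 * \1_(bad k) w) =
    \sum_(k < n) mean P (fun w => 2 * \1_(bad k) w).
  by apply: mean_sum => k _; exact: bbad.
have h1 : \sum_(i in S) mean P (fun w => s%:R^-1 * \1_(~` A t i) w) = 1 - rho.
  rewrite (eq_bigr (fun=> s%:R^-1 * (1 - rho))).
    by rewrite sumr_const sE -[LHS]mulr_natl mulrA divff ?mul1r// lt0r_neq0.
  move=> i _; rewrite meanZ; last by apply: bm_ind; exact: measurableC.
  rewrite mean_ind; last exact: measurableC.
  by rewrite prC// prA.
have h2 := tailN t (mulr_gt0 s0' rho0).
have h3 : (s%:R^-1 + 2 / (s%:R * rho)) * mean P V <= 4 * alpha + 8 * alpha / rho.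
  apply: le_trans (ler_wpM2l _ meanV) _.
    by rewrite addr_ge0 ?invr_ge0 ?divr_ge0 ?mulr_ge0// ltW.
  by apply: eq_ler; field; rewrite !lt0r_neq0.
have h4 : \sum_(k < n) mean P (fun w => 2 * \1_(bad k) w) <= 16 / M.
  apply: le_trans (_ : \sum_(k < n) 8 / M * ((2 ^ k)%:R : R)^-1 <= _).
    apply: ler_sum => k _; rewrite meanZ; last exact: bm_ind.
    by rewrite mean_ind//; have := prbad k; lra.
  rewrite -mulr_sumr; have := geometric_half_sum R n.
  have : 0 <= 8 / M by rewrite divr_ge0// ltW.
  by move=> H1 H2; have := ler_wpM2l H1 H2; lra.
rewrite h1 /rho in h2 *; lra.
Qed.
End upper.

(** * Finite-sample lower bound for every procedure *)

(** The pair of a set S and i in S is exchanged for S without i, and i. *)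
Lemma sum_remove_add (R : nmodType) (I : finType) (s : nat) (G : {set I} -> I -> R) :
  \sum_(S : {set I} | #|S| == s.+1) \sum_(i in S) G S i =
  \sum_(S : {set I} | #|S| == s) \sum_(i | i \notin S) G (i |: S)%SET i.
Proof.
rewrite !pair_big_dep/=.
rewrite (reindex_onto (fun p => (p.2 |: p.1, p.2)%SET) (fun p => (p.1 :\ p.2, p.2)%SET)).
  apply: eq_bigl => -[S i] /=; rewrite setU11 andbT.
  apply/andP/andP => [[/eqP c /eqP[SE]]|[/eqP c iS]].
    have iS : i \notin S by rewrite -SE !inE eqxx.
    by split => //; move: c; rewrite cardsU1 iS add1n => -[<-].
  by rewrite cardsU1 iS c add1n eqxx setU1K.
by move=> [S i] /= /andP[_ iS]; rewrite finset.setD1K.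
Qed.

Section weighted_loss.
Context (R : realType) (n s : nat) (K : R).
Hypotheses (s0 : (0 < s)%N) (K1 : 1 < K).

(** More than K s rejections already cost 1 - 1 / K in FDP, as much as the scaled
linear loss charges for rejecting nothing. *)
Definition truncated_reject (phi : n.-tuple bool) (i : 'I_n) : bool :=
  tnth phi i && ((\sum_(j < n) tnth phi j)%:R <= K * s%:R).

(** If at most K s hypotheses are rejected, the denominator of the FDP is at most
K s. Otherwise at most s of more than K s rejections are correct, hence
FDP >= 1 - 1 / K, and the left-hand side is that of the empty decision. *)
Lemma loss_ge_weighted (theta : n.-tuple R) (phi : n.-tuple bool) :
  #|signals theta| = s ->
  (1 - K^-1) / s%:R * (\sum_(i in signals theta) (~~ truncated_reject phi i)%:R
    + K^-1 * \sum_(i | i \notin signals theta) (truncated_reject phi i)%:R)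
  <= loss s theta phi.
Proof.
move=> sE; have s0' : 0 < s%:R :> R by rewrite ltr0n.
have K0 : 0 < K by exact: lt_trans K1.
have Ki : 0 < K^-1 by rewrite invr_gt0.
have Ki1 : K^-1 < 1 by rewrite invf_lt1.
have s1 : 1 <= s%:R :> R by rewrite (ler_nat R 1).
rewrite /loss FNPE// /FDP false_rejectionsE natr_sum.
set r := (\sum_(j < n) tnth phi j)%N.
have rE : r%:R = \sum_(i in signals theta) (tnth phi i)%:R +
    \sum_(i | i \notin signals theta) (tnth phi i)%:R :> R.
  by rewrite /r natr_sum (bigID (mem (signals theta))).
have hitle : \sum_(i in signals theta) (tnth phi i)%:R <= s%:R :> R.
  by rewrite -sE -sumr_const; apply: ler_sum => i _; case: (tnth phi i).
set V := \sum_(i | i \notin signals theta) (tnth phi i)%:R in rE *.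
have V0 : 0 <= V by apply: sumr_ge0 => i _.
have [rK|rK] := leP (r%:R) (K * s%:R).
  have tE i : truncated_reject phi i = tnth phi i by rewrite /truncated_reject rK andbT.
  under eq_bigr do rewrite tE.
  under [\sum_(i | i \notin _) (truncated_reject _ _)%:R]eq_bigr do rewrite tE.
  rewrite -/V; set W := \sum_(i in _) _.
  have W0 : 0 <= W by apply: sumr_ge0 => i _.
  have m0 : 0 < (maxn 1 r)%:R :> R by rewrite ltr0n leq_max.
  have : V / (K * s%:R) <= V / (maxn 1 r)%:R.
    rewrite ler_wpM2l// lef_pV2 ?posrE ?mulr_gt0//.
    rewrite natr_max ge_max rK andbT.
    by rewrite (le_trans s1)// ler_peMl// ltW.
  rewrite invfM mulrA => H.
  apply: le_trans (_ : V / K / s%:R + W / s%:R <= _); last by rewrite lerD2r.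
  rewrite -mulrDl mulrAC ler_pM2r ?invr_gt0//.
  have WV : 0 <= W + K^-1 * V by rewrite addr_ge0// mulr_ge0// ltW.
  rewrite [leRHS]addrC [V / K]mulrC ler_piMl// gerBl ltW//.
have tE i : truncated_reject phi i = false.
  by rewrite /truncated_reject leNgt rK andbF.
under eq_bigr do rewrite tE.
rewrite [X in K^-1 * X]big1; last by move=> i _; rewrite tE.
rewrite mulr0 addr0 sumr_const sE divfK ?lt0r_neq0//.
have r0 : 0 < r%:R :> R by apply: lt_trans rK; rewrite mulr_gt0.
have -> : maxn 1 r = r by apply/maxn_idPr; rewrite -(ltr_nat R).
apply: le_trans (_ : V / r%:R <= _); last first.
  by rewrite lerDl divr_ge0// sumr_ge0.
rewrite ler_pdivlMr//.
have h : s%:R <= K^-1 * r%:R by rewrite mulrC ler_pdivlMr// mulrC ltW.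
lra.
Qed.
End weighted_loss.

Definition sparse_mean (R : realType) n (mu : R) (S : {set 'I_n}) : n.-tuple R :=
  [tuple if i \in S then mu else 0 | i < n].

Lemma signals_sparse_mean (R : realType) n (mu : R) (S : {set 'I_n}) :
  mu != 0 -> signals (sparse_mean mu S) = S.
Proof.
by move=> mu0; apply/setP => i; rewrite inE tnth_mktuple; case: ifP; rewrite ?eqxx.
Qed.

Lemma sparse_mean_add (R : realType) n (mu : R) (S : {set 'I_n}) i : i \notin S ->
  sparse_mean mu (i |: S)%SET = shift_coord (sparse_mean mu S) i mu.
Proof.
move=> iS; apply: eq_from_tnth => k; rewrite !tnth_mktuple in_setU1.
case: (eqVneq k i) => [->|_]; first by rewrite (negbTE iS) add0r.
by rewrite addr0.
Qed.

Section lower.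
Context d (T : measurableType d) (R : realType) (P : probability T R) (n : nat)
  (eps : 'I_n -> {RV P >-> R}).
Hypothesis iid : iid_std_normal eps.
Local Notation pr := (pr P).
Variables (mu y t N0 c : R).
Hypotheses (mu0 : 0 < mu) (c0 : 0 < c)
  (gap : expR (mu * y) <= c * (N0 * expR (mu * t))).

Let Q S (A : set (n.-tuple R)) := pr (observation eps (sparse_mean mu S) @^-1` A).

Let mQ S (A : set (n.-tuple R)) : measurable A ->
  measurable (observation eps (sparse_mean mu S) @^-1` A).
Proof. exact: measurable_obs_preimage. Qed.

Let L i (w : T) : R := expR (mu * eps i w - mu ^+ 2 / 2).

Let mL i : measurable_fun setT (L i).
Proof.
apply: measurableT_comp => //; apply: measurable_funB => //.
by apply: measurable_funM => //; exact: measurable_funPT.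
Qed.

Let Q_add (S : {set 'I_n}) i (A : set (n.-tuple R)) : measurable A -> i \notin S ->
  ((Q (i |: S)%SET A)%:E =
   \int[P]_(w in observation eps (sparse_mean mu S) @^-1` A) (L i w)%:E)%E.
Proof.
move=> mA iS; rewrite /Q prE; last exact: mQ.
by rewrite sparse_mean_add// (shift_likelihood iid).
Qed.

Section one_coordinate.
Variables (S : {set 'I_n}) (k : 'I_n).
Hypothesis kS : k \notin S.
Let J := (~: S :\ k)%SET.

(** The event on which a signal at k cannot be told from a signal elsewhere: k is
below the level y, and at least N0 coordinates free of the other signals are
above t. *)
Definition hard_set : set (n.-tuple R) :=
  [set x | tnth x k <= y] `&` [set x | N0 <= \sum_(i in J) \1_(`[t, +oo[%classic) (tnth x i)].

Lemma measurable_hard_set : measurable hard_set.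
Proof.
apply: measurableI.
  by apply: measurable_set_le => //; exact: measurable_tnth.
apply: measurable_set_le => //.
under eq_fun do rewrite big_mkcond; apply: measurable_sum => i.
case: (i \in J) => //.
apply: (@measurableT_comp _ _ _ _ _ _ (\1_(`[t, +oo[%classic) : R -> R)) => //.
exact: measurable_tnth.
Qed.

(** The Neyman-Pearson argument. By [gap], on [hard_set] the likelihood ratio of a
signal at k is at most c times the sum of those of the signals in [J]; there,
rejecting k costs at least as much in false rejections as it saves in misses. *)
Lemma testing_lower (A : set (n.-tuple R)) : measurable A ->
  Q (k |: S)%SET hard_set <=
  Q (k |: S)%SET (~` A) + c * \sum_(i in J) Q (i |: S)%SET A.
Proof.
move=> mA; have mB := measurable_hard_set.
have mAB := measurableI _ _ mA mB.
have JS i : i \in J -> i \notin S by rewrite !inE => /andP[].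
apply: le_trans (_ : Q (k |: S)%SET (~` A) + Q (k |: S)%SET (A `&` hard_set) <= _).
  rewrite /Q; apply: le_trans (prU _ _ _); [|exact/mQ/measurableC|exact: mQ].
  apply: pr_le; [exact: mQ| |].
    by apply: measurableU; apply: mQ => //; exact: measurableC.
  by move=> w Bw; have [Aw|nAw] := pselect (A (observation eps (sparse_mean mu (k |: S)%SET) w));
    [right|left].
rewrite lerD2l -lee_fin Q_add// EFinM -sumEFin.
pose D := observation eps (sparse_mean mu S) @^-1` (A `&` hard_set).
have mD : measurable D by exact: mQ.
have mLE i (E : set T) : measurable_fun E (EFin \o L i).
  by apply/measurable_EFinP; exact: measurable_funTS.
have mLsum (E : set T) : measurable_fun E (fun w => \sum_(i in J) (L i w)%:E)%E.
  under eq_fun do rewrite sumEFin; apply/measurable_EFinP/measurable_funTS.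
  under eq_fun do rewrite big_mkcond; apply: measurable_sum => i.
  by case: (i \in J).
apply: le_trans (_ : \int[P]_(w in D) (c%:E * \sum_(i in J) (L i w)%:E) <= _)%E.
  apply: ge0_le_integral => //.
  - by move=> w _; rewrite lee_fin expR_ge0.
  - exact: mLE.
  - by apply: measurable_funeM; exact: mLsum.
  move=> w [_ [/= ky N0J]]; rewrite sumEFin -EFinM lee_fin.
  rewrite tnth_mktuple tnth_mktuple (negbTE kS) add0r in ky.
  have e0 := expR_gt0 (- (mu ^+ 2 / 2)).
  apply: le_trans (_ : expR (mu * y) * expR (- (mu ^+ 2 / 2)) <= _).
    by rewrite -expRD ler_expR lerD2r ler_pM2l.
  apply: le_trans (ler_wpM2r (ltW e0) gap) _.
  rewrite -mulrA ler_pM2l// -mulrA -expRD.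
  apply: le_trans (ler_wpM2r (expR_ge0 _) N0J) _.
  rewrite mulr_suml; apply: ler_sum => i iJ.
  rewrite tnth_mktuple tnth_mktuple (negbTE (JS _ iJ)) add0r indicE.
  case: (boolP (_ \in _)) => [|_]; last by rewrite mul0r expR_ge0.
  by rewrite inE/= in_itv/= andbT mul1r ler_expR lerD2r ler_pM2l.
rewrite ge0_integralZl//; last 2 first.
- by move=> w _; rewrite sume_ge0// => i _; rewrite lee_fin expR_ge0.
- by rewrite lee_fin ltW.
apply: lee_wpmul2l; first by rewrite lee_fin ltW.
under eq_integral do rewrite -big_enum.
rewrite ge0_integral_sum//; last 2 first.
- by move=> i; exact: mLE.
- by move=> i w _; rewrite lee_fin expR_ge0.
rewrite big_enum; apply: lee_sum => i iJ; rewrite Q_add//; last exact: JS.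
apply: ge0_subset_integral => //; [exact: mQ|exact: mLE| |].
  by move=> w _; rewrite lee_fin expR_ge0.
by move=> w [].
Qed.

Lemma hard_set_prob : 0 < #|J|%:R * Phibar t -> N0 <= #|J|%:R * Phibar t / 2 ->
  Phi (y - mu) - 4 / (#|J|%:R * Phibar t) <= Q (k |: S)%SET hard_set.
Proof.
move=> Jt N0J.
have mE i (B : set R) : measurable B -> measurable (eps i @^-1` B) by exact: measurable_eps.
pose few := [set w | \sum_(i in J) \1_(eps i @^-1` `[t, +oo[) w < #|J|%:R * Phibar t / 2].
have mfew : measurable few.
  apply: measurable_set_lt => //.
  suff [] : bounded_measurable (fun w => \sum_(i in J) \1_(eps i @^-1` `[t, +oo[) w : R) by [].
  by apply: bm_sum => i _; apply: bm_ind; exact: mE.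
have few_le : pr few <= 4 / (#|J|%:R * Phibar t).
  apply: count_lower_tail => //.
  - by move=> i; exact: mE.
  - by move=> i _; rewrite (pr_eps_ge iid).
  - by move=> i j _ _ ij; rewrite (eps_indep2 iid)// !(pr_eps_ge iid).
rewrite lerBlDr -(pr_eps_le iid k).
apply: le_trans (lerD (lexx _) few_le).
have mH : measurable (observation eps (sparse_mean mu (k |: S)%SET) @^-1` hard_set).
  by apply: mQ; exact: measurable_hard_set.
apply: le_trans (prU _ mH mfew); apply: pr_le; [exact: mE|exact: measurableU|].
move=> w /=; rewrite in_itv/= => ky.
have [fw|nfw] := pselect (few w); [by right|left].
split => /=.
  by rewrite !tnth_mktuple setU11; lra.
apply: (le_trans N0J); move/negP: nfw; rewrite -leNgt => /le_trans; apply.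
apply: ler_sum => i; rewrite !inE => /andP[ik iS].
rewrite !tnth_mktuple !inE (negbTE ik) (negbTE iS) /= add0r.
by rewrite !indicE.
Qed.
End one_coordinate.
End lower.

(** The maximum over supports is at least the average. In the average of the
linear loss, both the miss of i and the false rejections shared by the elements
of the support are attached to a pair of a support and one of its elements i.
After removing i from the support, summing over i and exchanging the roles of i
and of the rejected coordinate k gives the two sides of [testing_lower]. *)
Lemma minimax_lower d (T : measurableType d) (R : realType) (P : probability T R)
    (n s : nat) (eps : 'I_n -> {RV P >-> R}) (phi : n.-tuple R -> n.-tuple bool)
    (K mu y t v : R) :
  iid_std_normal eps -> measurable_fun setT phi -> 1 < K -> (s.+1 < n)%N -> 0 < mu ->
  expR (mu * y) <= (s.+1%:R * K)^-1 * ((n - s.+1)%:R * Phibar t / 2 * expR (mu * t)) ->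
  (forall S : {set 'I_n}, #|S| = s.+1 ->
     (risk eps s.+1 phi (sparse_mean mu S) <= v%:E)%E) ->
  (1 - K^-1) * (Phi (y - mu) - 4 / ((n - s.+1)%:R * Phibar t)) <= v.
Proof.
move=> iid mphi K1 sn mu0 gap riskv.
have K0 : 0 < K by exact: lt_trans K1.
have s0 : 0 < s.+1%:R :> R by rewrite ltr0n.
set c := (s.+1%:R * K)^-1 in gap.
have c0 : 0 < c by rewrite invr_gt0 mulr_gt0.
have Ki1 : 0 < 1 - K^-1 by rewrite subr_gt0 invf_lt1.
have mun0 : mu != 0 by rewrite lt0r_neq0.
pose A i : set (n.-tuple R) := [set x | truncated_reject s.+1 K (phi x) i].
have mA i : measurable (A i).
  have := mphi measurableT _ (measurable_bool_tuple [set p | truncated_reject s.+1 K p i]).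
  by rewrite setTI.
pose q (S : {set 'I_n}) (B : set (n.-tuple R)) := pr P (observation eps (sparse_mean mu S) @^-1` B).
have mq (S : {set 'I_n}) (B : set (n.-tuple R)) : measurable B ->
    measurable (observation eps (sparse_mean mu S) @^-1` B).
  exact: measurable_obs_preimage.
pose F (S : {set 'I_n}) i := q S (~` A i) + c * \sum_(k | k \notin S) q S (A k).
set beta := Phi (y - mu) - _.
have avg (S : {set 'I_n}) : #|S| = s.+1 -> \sum_(i in S) F S i <= s.+1%:R * v / (1 - K^-1).
  move=> Sc; rewrite ler_pdivlMr// mulrC -ler_pdivrMl//.
  rewrite mulrA [_^-1 * _]mulrC.
  have sS := signals_sparse_mean S mun0.
  pose X w := observation eps (sparse_mean mu S) w.
  pose low w : R := (1 - K^-1) / s.+1%:R * (\sum_(i in S) \1_(X @^-1` (~` A i)) w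
    + K^-1 * \sum_(i | i \notin S) \1_(X @^-1` A i) w).
  have blow1 : bounded_measurable (fun w => \sum_(i in S) \1_(X @^-1` (~` A i)) w : R).
    by apply: bm_sum => i _; apply: bm_ind; apply: mq; exact: measurableC.
  have blow2 : bounded_measurable (fun w => \sum_(i | i \notin S) \1_(X @^-1` A i) w : R).
    by apply: bm_sum => i _; apply: bm_ind; exact: mq.
  have blow3 := bmZ K^-1 blow2; have blow4 := bmD blow1 blow3.
  have blow : bounded_measurable low by exact: bmZ.
  have bloss : bounded_measurable (fun w => loss s.+1 (sparse_mean mu S) (phi (X w))).
    apply: (@bm_bool_tuple _ _ _ _ (fun w => phi (X w)) (loss s.+1 (sparse_mean mu S))).
    by apply: (measurableT_comp mphi); exact: measurable_observation.
  have := riskv S Sc; rewrite [risk _ _ _ _](E_mean P bloss) lee_fin; apply: le_trans.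
  apply: le_trans (_ : mean P low <= _); last first.
    apply: mean_le => // w.
    have := @loss_ge_weighted R n s.+1 K isT K1 (sparse_mean mu S) (phi (X w)).
    rewrite sS => /(_ Sc); apply: le_trans.
    rewrite ler_pM2l ?divr_gt0// lerD//.
      apply: ler_sum => i _; rewrite indicE; case: (boolP (w \in _)) => //.
      rewrite inE /A /= => /negP; by case: truncated_reject.
    rewrite ler_pM2l ?invr_gt0//; apply: ler_sum => i _.
    rewrite indicE; case: (boolP (w \in _)) => //.
    by rewrite inE /A /= => ->.
  rewrite meanZ// meanD// meanZ// !mean_sum; last 2 first.
  - by move=> i _; apply: bm_ind; exact: mq.
  - by move=> i _; apply: bm_ind; apply: mq; exact: measurableC.
  rewrite ler_pM2l ?divr_gt0// /F big_split/= sumr_const Sc.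
  apply: lerD.
    apply: ler_sum => i _; rewrite mean_ind//; apply: mq; exact: measurableC.
  rewrite -[leLHS]mulr_natl mulrA.
  have -> : s.+1%:R * c = K^-1 by rewrite /c; field; rewrite !lt0r_neq0.
  rewrite ler_pM2l ?invr_gt0//; apply: ler_sum => i _; rewrite mean_ind//; exact: mq.
(* for fixed S, the false rejections of k are regrouped with the misses of k *)
have local (S : {set 'I_n}) : #|S| = s ->
    \sum_(i | i \notin S) beta <= \sum_(i | i \notin S) F (i |: S)%SET i.
  move=> Sc; rewrite /F [leRHS]big_split/= -mulr_sumr.
  rewrite (exchange_big_dep (fun k => k \notin S))/=; last first.
    by move=> i k _; rewrite !inE negb_or => /andP[].
  rewrite mulr_sumr -big_split/=; apply: ler_sum => k kS.
  have Jc : #|(~: S :\ k)%SET| = (n - s.+1)%N.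
    have := cardsD1 k (~: S)%SET; rewrite inE kS add1n => e.
    by have := cardsC S; rewrite e Sc card_ord addnS => nE; rewrite -[X in (X - _)%N]nE subSS addKn.
  have JE : \sum_(i in (~: S :\ k)%SET) q (i |: S)%SET (A k) =
      \sum_(i | (i \notin S) && (k \notin (i |: S)%SET)) q (i |: S)%SET (A k).
    apply: eq_bigl => i; rewrite !inE negb_or kS andbT [k == i]eq_sym.
    by rewrite andbC.
  rewrite -JE; have Pt := Phibar_gt0 t.
  have J0 : 0 < (n - s.+1)%:R :> R by rewrite ltr0n subn_gt0.
  have := @testing_lower _ T R P n eps iid mu y t _ c mu0 c0 gap S k kS (A k) (mA k).
  apply: le_trans.
  have := @hard_set_prob _ T R P n eps iid mu y t ((n - s.+1)%:R * Phibar t / 2) S k.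
  by rewrite Jc; apply => //; exact: mulr_gt0.
have total : \sum_(S : {set 'I_n} | #|S| == s.+1) s.+1%:R * beta <=
    \sum_(S : {set 'I_n} | #|S| == s.+1) s.+1%:R * v / (1 - K^-1).
  apply: le_trans (_ : \sum_(S : {set 'I_n} | #|S| == s.+1) \sum_(i in S) F S i <= _);
    last by apply: ler_sum => S /eqP; exact: avg.
  rewrite sum_remove_add.
  rewrite (eq_bigr (fun S : {set 'I_n} => \sum_(i in S) beta)); last first.
    by move=> S /eqP Sc; rewrite sumr_const Sc mulr_natl.
  rewrite (sum_remove_add s (fun _ _ => beta)).
  by apply: ler_sum => S /eqP; exact: local.
have [S0 S0c] : exists S : {set 'I_n}, #|S| = s.+1.
  have le : (s.+1 <= #|[set: 'I_n]%SET|)%N by rewrite cardsT card_ord ltnW.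
  have : (0 < 'C(#|[set: 'I_n]%SET|, s.+1))%N by rewrite bin_gt0.
  rewrite -(cards_draws [set: 'I_n]%SET s.+1) card_gt0 => /set0Pn[S].
  by rewrite inE => /andP[_ /eqP]; exists S.
move: total; rewrite !sumr_const ler_pMn2r; last first.
  by apply/card_gt0P; exists S0; rewrite unfold_in /= S0c; apply/eqP.
rewrite -mulrA ler_pM2l// ler_pdivlMr// mulrC; exact.
Qed.

(** * Asymptotics *)

Section finite_risk.
Context d (T : measurableType d) (R : realType) (P : probability T R) (n s : nat)
  (eps : 'I_n -> {RV P >-> R}) (b : R).
Hypothesis (sn : (0 < s <= n)%N).

Let s0 : (0 < s)%N. Proof. by case/andP: sn. Qed.

Lemma exists_card : exists S : {set 'I_n}, #|S| = s.
Proof.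
have /andP[_ le] := sn; rewrite -[n in (_ <= n)%N]card_ord -cardsT in le.
have : (0 < 'C(#|[set: 'I_n]%SET|, s))%N by rewrite bin_gt0.
rewrite -(cards_draws [set: 'I_n]%SET s) card_gt0 => /set0Pn[S].
by rewrite inE => /andP[_ /eqP]; exists S.
Qed.

Lemma sparse_mean_in_Theta mu (S : {set 'I_n}) : 0 < mu ->
  Num.sqrt (2 * ln (n%:R / s%:R)) + b <= mu -> #|S| = s ->
  @Theta_b R n s b (sparse_mean mu S).
Proof.
move=> mu0 bm Sc; rewrite /Theta_b /= signals_sparse_mean ?lt0r_neq0//; split => // i iS.
by rewrite tnth_mktuple iS gtr0_norm.
Qed.

Variable phi : n.-tuple R -> n.-tuple bool.

Lemma risk_ge0 theta : (0 <= risk eps s phi theta)%E.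
Proof. by apply: expectation_ge0 => w; exact: loss_ge0. Qed.

Hypothesis mphi : measurable_fun setT phi.

Lemma risk_le2 theta : #|signals theta| = s -> (risk eps s phi theta <= 2%:E)%E.
Proof.
move=> sE.
have bl : bounded_measurable (fun w => loss s theta (phi (observation eps theta w))).
  apply: (@bm_bool_tuple _ _ _ _ (fun w => phi (observation eps theta w)) (loss s theta)).
  by apply: (measurableT_comp mphi); exact: measurable_observation.
rewrite [risk _ _ _ _](E_mean P bl) lee_fin -[leRHS](mean_cst P).
by apply: mean_le => //; [exact: bm_cst|move=> w; exact: loss_le2].
Qed.

Lemma max_risk_le2 : (max_risk eps s b phi <= 2%:E)%E.
Proof. by apply: ub_ereal_sup => _ [theta [sE _] <-]; exact: risk_le2. Qed.

Lemma max_risk_ge0 : (0 <= max_risk eps s b phi)%E.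
Proof.
have [S Sc] := exists_card.
pose mu := Num.max 1 (Num.sqrt (2 * ln (n%:R / s%:R)) + b) : R.
apply: le_trans (risk_ge0 (sparse_mean mu S)) _; apply: ereal_sup_ubound.
exists (sparse_mean mu S) => //; apply: sparse_mean_in_Theta => //.
  by rewrite lt_max ltr01.
by rewrite le_max lexx orbT.
Qed.

Lemma max_risk_fin : max_risk eps s b phi \is a fin_num.
Proof.
rewrite ge0_fin_numE ?max_risk_ge0//.
exact: le_lt_trans max_risk_le2 (ltry _).
Qed.
End finite_risk.

Section asymptotics.
Context (R : realType) (s : nat -> nat) (alpha : nat -> R) (b : R).
Hypotheses (sn : forall n : nat, (0 < n)%N -> (0 < s n <= n)%N)
  (alpha01 : forall n : nat, (0 < n)%N -> 0 < alpha n < 1)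
  (sy : s @ \oo --> \oo)
  (nsy : (fun n : nat => n%:R / (s n)%:R : R) @ \oo --> +oo)
  (alpha_cvg : alpha @ \oo --> (0 : R))
  (alpha_o : (fun n : nat => ln (1 / alpha n) : R^o) =o_\oo
    (fun n : nat => Num.sqrt (ln (n%:R / (s n)%:R)) : R^o)).

Let a n : R := Num.sqrt (2 * ln (n%:R / (s n)%:R)).

Let ratio_ge1 n : (0 < n)%N -> 1 <= n%:R / (s n)%:R :> R.
Proof.
move=> n0; have /andP[s0 sle] := sn n0.
by rewrite ler_pdivlMr ?ltr0n// mul1r ler_nat.
Qed.

Let a_sqr n : (0 < n)%N -> expR (- (a n ^+ 2 / 2)) = (s n)%:R / n%:R.
Proof.
move=> n0; have r1 := ratio_ge1 n0.
have r0 : 0 < n%:R / (s n)%:R :> R by exact: lt_le_trans r1.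
rewrite /a sqr_sqrtr; last by rewrite mulr_ge0// ln_ge0.
rewrite [2 * _]mulrC mulfK// expRN lnK ?posrE//.
by rewrite invf_div.
Qed.

Let near_pos : \forall n \near \oo, (0 < n)%N.
Proof. exact: nbhs_infty_gt. Qed.

Let near_ratio (C : R) : \forall n \near \oo, C <= n%:R / (s n)%:R.
Proof. by move/cvgryPge : nsy; exact. Qed.

Let near_a (C : R) : \forall n \near \oo, C <= a n.
Proof.
near=> n.
apply: le_trans (ler_norm C) _.
rewrite -sqrtr_sqr /a ler_wsqrtr//.
have : expR (`|C| ^+ 2 / 2) <= n%:R / (s n)%:R by near: n; exact: near_ratio.
move=> H; have := H; rewrite -ler_ln ?posrE ?expR_gt0 ?(lt_le_trans _ H) ?expR_gt0//.
by rewrite expRK real_normK ?num_real//; lra.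
Unshelve. all: by end_near. Qed.

Let near_s (C : nat) : \forall n \near \oo, (C <= s n)%N.
Proof. by move/cvgnyPge : sy; exact. Qed.

Let near_sR (C : R) : \forall n \near \oo, C <= (s n)%:R.
Proof.
near=> n; apply: le_trans (ltW (truncnS_gt C)) _; rewrite ler_nat.
by near: n; exact: near_s.
Unshelve. all: by end_near. Qed.

Let near_alpha (e : R) : 0 < e -> \forall n \near \oo, alpha n <= e.
Proof.
move=> e0; near=> n; apply: le_trans (ler_norm _) _.
rewrite -[alpha n]subr0 -normrN opprB.
by near: n; move/cvgrPdist_le : alpha_cvg; exact.
Unshelve. all: by end_near. Qed.

Let near_alpha_exp (e : R) : 0 < e -> \forall n \near \oo, expR (- (e * a n)) <= alpha n.
Proof.
move=> e0; near=> n.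
have n0 : (0 < n)%N by near: n; exact: near_pos.
have /andP[al0 al1] := alpha01 n0.
have : `|ln (1 / alpha n)| <= e * `|Num.sqrt (ln (n%:R / (s n)%:R))|.
  by near: n; move/eqoP : alpha_o; exact.
rewrite [`|Num.sqrt _|]ger0_norm ?sqrtr_ge0// => H.
have sq : Num.sqrt (ln (n%:R / (s n)%:R)) <= a n.
  by rewrite /a ler_wsqrtr//; have := ln_ge0 (ratio_ge1 n0); lra.
have {}H : ln (1 / alpha n) <= e * a n.
  by apply: le_trans (ler_norm _) _; apply: (le_trans H); rewrite ler_pM2l.
rewrite -[leRHS]lnK ?posrE// ler_expR.
by move: H; rewrite div1r lnV ?posrE//; lra.
Unshelve. all: by end_near. Qed.

Section upper.
Context (d : nat -> measure_display) (T : forall n : nat, measurableType (d n))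
    (P : forall n : nat, probability (T n) R)
    (eps : forall n : nat, 'I_n -> {RV (P n) >-> R}).
Arguments eps : clear implicits.
Hypothesis iid : forall n : nat, iid_std_normal (eps n).

Lemma gbs_max_risk_near (e : R) : 0 < e -> \forall n \near \oo,
  (max_risk (eps n) (s n) b (gbs (alpha n)) <= (Phibar b + e)%:E)%E.
Proof.
move=> e0; pose del := e / 2; have del0 : 0 < del by rewrite divr_gt0.
pose rho : R := Phibar (del - b); have rho0 : 0 < rho by exact: Phibar_gt0.
have rho_ge : 1 - rho <= Phibar b + del.
  have -> : 1 - rho = Phibar (b - del).
    by rewrite /rho -[in RHS](opprB del b) PhibarN /Phibar; lra.
  by have := @Phibar_lip R (b - del) b ltac:(lra); lra.
(* the four error terms of gbs_risk_bound share the other half of e *)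
have err1 x : 0 < x -> 128 / e <= x -> 16 / x <= e / 8.
  by move=> x0; rewrite !ler_pdivrMr//; lra.
have err2 x : 0 < x -> 32 / (e * rho) <= x -> 4 / (x * rho) <= e / 8.
  by move=> x0; rewrite !ler_pdivrMr ?mulr_gt0//; lra.
have err3 x : x <= e / 32 -> 4 * x <= e / 8 by lra.
have err4 x : x <= e * rho / 64 -> 8 * x / rho <= e / 8.
  by rewrite ler_pdivrMr//; lra.
pose B := Num.max 4 (128 / e); have B0 : 0 < B by rewrite lt_max ltr0n.
near=> n.
have n0 : (0 < n)%N by near: n; exact: near_pos.
have /andP[s0 sle] := sn n0; have al01 := alpha01 n0; have /andP[al0 al1] := al01.
have s0' : 0 < (s n)%:R :> R by rewrite ltr0n.
have n0' : 0 < n%:R :> R by rewrite ltr0n.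
have a_mu : 0 <= a n + b.
  suff : - b <= a n by lra.
  by near: n; exact: near_a.
have a0 : 0 <= a n by exact: sqrtr_ge0.
have s4 : (4 * s n <= n)%N.
  rewrite -(ler_nat R) natrM -ler_pdivlMr//.
  by near: n; exact: near_ratio.
pose t := a n + del; have t0 : 0 <= t by rewrite addr_ge0// ltW.
have tmu : t - (a n + b) = del - b by rewrite /t; ring.
have Pt : Phibar t <= (s n)%:R / n%:R * expR (- (del * a n)).
  apply: le_trans (Phibar_tail t0) _; rewrite -a_sqr// -expRD ler_expR /t.
  have := sqr_ge0 del; lra.
have Pt0 := Phibar_gt0 t.
set M := (s n)%:R * Phibar (t - (a n + b)) * alpha n / ((n%:R + 1) * (2 * Phibar t)).
have MB : B <= M.
  (* Phibar t gains exp (- del * a) over s / n, and alpha costs at most half of it *)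
  have step1 : rho / 4 * expR (del / 2 * a n) <= M.
    rewrite /M tmu -/rho ler_pdivlMr; last by rewrite !mulr_gt0// ltr_wpDl.
    have al_ge : expR (- (del / 2 * a n)) <= alpha n.
      by near: n; apply: near_alpha_exp; rewrite divr_gt0.
    have n1 : n%:R + 1 <= 2 * n%:R :> R.
      have : 1 <= n%:R :> R by rewrite (ler_nat R 1).
      lra.
    apply: le_trans (_ : rho / 4 * expR (del / 2 * a n) *
      ((2 * n%:R) * (2 * ((s n)%:R / n%:R * expR (- (del * a n))))) <= _).
      apply: ler_wpM2l; first by rewrite mulr_ge0 ?expR_ge0// divr_ge0// ltW.
      apply: ler_pM => //; last by rewrite ler_pM2l.
      by rewrite mulr_ge0// ltW.
    rewrite [leLHS](_ : _ = (s n)%:R * rho * expR (- (del / 2 * a n))).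
      by rewrite ler_wpM2l// mulr_ge0// ltW.
    have -> : - (del * a n) = - (del / 2 * a n) + - (del / 2 * a n) by field.
    rewrite expRD [expR (del / 2 * a n)](_ : _ = (expR (- (del / 2 * a n)))^-1).
      by field; rewrite !lt0r_neq0// expR_gt0.
    by rewrite expRN invrK.
  apply: le_trans step1.
  have e1 : del / 2 * a n <= expR (del / 2 * a n).
    by apply: le_trans (expR_ge1Dx _); lra.
  apply: le_trans (_ : rho / 4 * (del / 2 * a n) <= _); last first.
    by rewrite ler_wpM2l// divr_ge0// ltW.
  have : B / (rho / 4 * (del / 2)) <= a n by near: n; exact: near_a.
  rewrite ler_pdivrMr; last by rewrite !mulr_gt0// invr_gt0.
  by move=> H; lra.
have M4 : 4 <= M by apply: le_trans MB; rewrite le_max lexx.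
have M0 : 0 < M by exact: lt_le_trans M4.
have term1 : 16 / M <= e / 8.
  by apply: err1 => //; apply: le_trans MB; rewrite le_max lexx orbT.
have term2 : 4 / ((s n)%:R * rho) <= e / 8.
  by apply: err2 => //; near: n; exact: near_sR.
have term3 : 4 * alpha n <= e / 8.
  by apply: err3; near: n; apply: near_alpha; rewrite divr_gt0.
have term4 : 8 * alpha n / rho <= e / 8.
  by apply: err4; near: n; apply: near_alpha; rewrite divr_gt0// mulr_gt0.
apply: ub_ereal_sup => _ [theta [sE bmin] <-].
have := @gbs_risk_bound _ _ R (P n) n (eps n) (iid n) theta (s n) (alpha n) (a n + b) t
  sE s0 s4 al01 a_mu t0 bmin M4.
move=> /le_trans; apply; rewrite -/M lee_fin tmu -/rho.
have -> : Phibar b + e = Phibar b + del + e / 8 + e / 8 + e / 8 + e / 8.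
  by rewrite /del; field.
by do 4 apply: lerD => //.
Unshelve. all: by end_near. Qed.

Lemma minimax_near (e : R) : 0 < e -> \forall n \near \oo,
  forall phi : n.-tuple R -> n.-tuple bool, measurable_fun setT phi ->
  ((Phibar b - e)%:E <= max_risk (eps n) (s n) b phi)%E.
Proof.
move=> e0; pose del := e / 4; have del0 : 0 < del by rewrite divr_gt0.
pose K := 1 + 4 / e; have K1 : 1 < K by rewrite ltrDl divr_gt0.
have K0 : 0 < K by exact: lt_trans K1.
have Ke : K^-1 <= e / 4.
  rewrite -[e / 4]invf_div lef_pV2 ?posrE ?divr_gt0//.
  by rewrite /K lerDr.
pose peak : R := normal_peak 1.
have peak0 : 0 < peak by rewrite normal_peak_gt0// oner_neq0.
(* exp (- C) absorbs the weight K and the constants of Phibar_lower; in the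
   threshold y it appears only as C / mu, which tends to 0 *)
pose C := ln (4 * K / (del * peak)).
near=> n; move=> phi mphi.
have n0 : (0 < n)%N by near: n; exact: near_pos.
have snn := sn n0; have /andP[s0 sle] := snn.
have s0' : 0 < (s n)%:R :> R by rewrite ltr0n.
have n0' : 0 < n%:R :> R by rewrite ltr0n.
pose mu := a n + b.
have mu0 : 0 < mu.
  suff : 1 - b <= a n by rewrite /mu; lra.
  by near: n; exact: near_a.
have a_del : 0 <= a n - del.
  suff : del <= a n by lra.
  by near: n; exact: near_a.
have s2 : 2 * (s n)%:R <= n%:R :> R.
  rewrite -ler_pdivlMr//; by near: n; exact: near_ratio.
have sltn : (s n < n)%N by rewrite -(ltr_nat R); lra.
pose t := a n - del; pose y := t - C / mu.
have Pt : del * peak * ((s n)%:R / n%:R) <= Phibar t.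
  apply: le_trans (Phibar_lower a_del (ltW del0)).
  by rewrite std_pdfE a_sqr// -mulrA.
pose m : R := (n - s n)%:R.
have mE : m = n%:R - (s n)%:R by rewrite /m natrB.
have m2 : n%:R / 2 <= m by rewrite mE; lra.
have m0 : 0 < m by apply: lt_le_trans m2; rewrite divr_gt0.
have Pt0 := Phibar_gt0 t.
have count_ge : (s n)%:R * (del * peak) / 2 <= m * Phibar t.
  apply: le_trans (_ : n%:R / 2 * (del * peak * ((s n)%:R / n%:R)) <= _).
    by apply: eq_ler; field; rewrite lt0r_neq0.
  apply: ler_pM => //.
  by apply: ltW; apply: mulr_gt0; [exact: mulr_gt0|exact: divr_gt0].
have gap : expR (mu * y) <= ((s n)%:R * K)^-1 * (m * Phibar t / 2 * expR (mu * t)).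
  have -> : mu * y = mu * t + - C by rewrite /y; field; rewrite lt0r_neq0.
  have CE : expR (- C) = (del * peak) / (4 * K).
    have q0 : 0 < 4 * K / (del * peak) by apply: divr_gt0; apply: mulr_gt0.
    by rewrite expRN /C lnK ?posrE// invf_div.
  rewrite expRD CE [leRHS]mulrA [leLHS]mulrC ler_pM2r ?expR_gt0//.
  rewrite ler_pdivrMr ?mulr_gt0//.
  apply: le_trans (_ : ((s n)%:R * K)^-1 * ((s n)%:R * (del * peak) / 2 / 2) * (4 * K) <= _).
    by apply: eq_ler; field; rewrite !lt0r_neq0.
  by rewrite ler_pM2r ?mulr_gt0// ler_pM2l ?invr_gt0 ?mulr_gt0// ler_pM2r ?invr_gt0.
have fin := @max_risk_fin _ _ R (P n) n (s n) (eps n) b snn phi mphi.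
have lower : (1 - K^-1) * (Phi (y - mu) - 4 / (m * Phibar t)) <=
    fine (max_risk (eps n) (s n) b phi).
  have sS : (s n).-1.+1 = s n by rewrite prednK.
  have := @minimax_lower _ (T n) R (P n) n (s n).-1 (eps n) phi K mu y t
     (fine (max_risk (eps n) (s n) b phi)) (iid n) mphi K1.
  rewrite sS => /(_ sltn mu0 gap); apply => S Sc; rewrite fineK//.
  apply: ereal_sup_ubound; exists (sparse_mean mu S) => //.
  exact: sparse_mean_in_Theta.
rewrite -(fineK fin) lee_fin; apply: le_trans lower.
have t1 : 4 / (m * Phibar t) <= e / 4.
  apply: le_trans (_ : 4 / ((s n)%:R * (del * peak) / 2) <= _).
    by rewrite ler_pM2l// lef_pV2 ?posrE ?mulr_gt0.
  have : 32 / (e * (del * peak)) <= (s n)%:R by near: n; exact: near_sR.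
  rewrite ler_pdivrMr ?mulr_gt0// => H.
  by rewrite ler_pdivrMr ?divr_gt0 ?mulr_gt0//; lra.
have t1' : 0 <= 4 / (m * Phibar t) by rewrite divr_ge0 ?mulr_ge0 ?ltW.
have t2 : C / mu <= e / 4.
  rewrite ler_pdivrMr// mulrC -ler_pdivrMr ?divr_gt0//.
  suff : C / (e / 4) - b <= a n by rewrite /mu; lra.
  by near: n; exact: near_a.
have t3 : Phibar b - e / 2 <= Phi (y - mu).
  rewrite -PhibarN.
  have -> : - (y - mu) = b + (del + C / mu) by rewrite /y /t /mu; ring.
  (* C may be negative *)
have [neg|pos] := leP (del + C / mu) 0.
    have : Phibar b <= Phibar (b + (del + C / mu)) by apply: Phibar_noninc; lra.
    lra.
  have := @Phibar_lip R b (b + (del + C / mu)) ltac:(lra).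
  rewrite /del in t2 *; lra.
have P1 : Phi (y - mu) <= 1 by rewrite -PhibarN Phibar_le1.
set q := Phi (y - mu) - _.
have q1 : q <= 1 by rewrite /q; lra.
have Kq : K^-1 * q <= K^-1 by rewrite ler_piMr// invr_ge0 ltW.
have q2 : Phibar b - e / 2 - e / 4 <= q by rewrite /q; lra.
rewrite mulrBl mul1r; lra.
Unshelve. all: by end_near. Qed.
End upper.
End asymptotics.

(** * Sharp minimaxity *)

Theorem theorem2 (R : realType)
    (d : nat -> measure_display) (T : forall n : nat, measurableType (d n))
    (P : forall n : nat, probability (T n) R)
    (eps : forall n : nat, 'I_n -> {RV (P n) >-> R})
    (s : nat -> nat) (alpha : nat -> R) (b : R) :
  (forall n : nat, iid_std_normal (eps n)) ->
  (forall n : nat, (0 < n)%N -> (0 < s n <= n)%N) ->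
  (forall n : nat, (0 < n)%N -> 0 < alpha n < 1) ->
  s @ \oo --> \oo ->
  (fun n : nat => n%:R / (s n)%:R : R) @ \oo --> +oo ->
  alpha @ \oo --> (0 : R) ->
  (fun n : nat => ln (1 / alpha n) : R^o) =o_\oo
    (fun n : nat => Num.sqrt (ln (n%:R / (s n)%:R)) : R^o) ->
  (exists r : nat -> R, r @ \oo --> (0 : R) /\
     forall n : nat, (0 < n)%N ->
       (max_risk (eps n) (s n) b (gbs (alpha n)) <= (Phibar b + r n)%:E)%E)
  /\
  (exists r : nat -> R, r @ \oo --> (0 : R) /\
     forall n : nat, (0 < n)%N ->
       (max_risk (eps n) (s n) b (gbs (alpha n))
          = minimax_risk (eps n) (s n) b + (r n)%:E)%E).
Proof.
move=> iid sn alpha01 sy nsy alpha_cvg alpha_o.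
pose MR n := max_risk (eps n) (s n) b (gbs (alpha n)).
pose MM n := minimax_risk (eps n) (s n) b.
have mgbs n : (0 < n)%N -> measurable_fun setT (@gbs R n (alpha n)).
  by move=> n0; apply: measurable_gbs; exact: alpha01.
have MRfin n : (0 < n)%N -> MR n \is a fin_num.
  by move=> n0; apply: max_risk_fin; [exact: sn|exact: mgbs].
have MMle n : (0 < n)%N -> (MM n <= MR n)%E.
  by move=> n0; apply: ereal_inf_lbound; exists (gbs (alpha n)) => //; exact: mgbs.
have MMfin n : (0 < n)%N -> MM n \is a fin_num.
  move=> n0; rewrite ge0_fin_numE.
    by rewrite (le_lt_trans (MMle n n0))// -ge0_fin_numE ?MRfin// max_risk_ge0// sn.
  by apply/ereal_infP => _ [phi mphi <-]; apply: max_risk_ge0; exact: sn.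
have upper := gbs_max_risk_near b sn alpha01 sy nsy alpha_cvg alpha_o iid.
have lower := minimax_near b sn sy nsy iid.
split.
  exists (fun n => Num.max 0 (fine (MR n) - Phibar b)); split; last first.
    move=> n n0; rewrite -/(MR n) -(fineK (MRfin n n0)) lee_fin.
    by rewrite -lerBlDl le_max lexx orbT.
  apply/cvgrPdist_le => e e0; near=> n.
  have n0 : (0 < n)%N by near: n; exact: nbhs_infty_gt.
  have : (MR n <= (Phibar b + e)%:E)%E by near: n; exact: upper.
  rewrite -(fineK (MRfin n n0)) lee_fin => le.
  rewrite sub0r normrN ger0_norm ?le_max ?lexx// ge_max ltW//=; lra.
exists (fun n => fine (MR n) - fine (MM n)); split; last first.
  move=> n n0; rewrite -/(MR n) -/(MM n) -[X in (X + _)%E](fineK (MMfin n n0)) -EFinD.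
  by rewrite addrC subrK fineK// MRfin.
apply/cvgrPdist_le => e e0; have e20 : 0 < e / 2 by rewrite divr_gt0.
near=> n; have n0 : (0 < n)%N by near: n; exact: nbhs_infty_gt.
have : (MR n <= (Phibar b + e / 2)%:E)%E by near: n; exact: upper.
have : ((Phibar b - e / 2)%:E <= MM n)%E.
  apply/ereal_infP => _ [phi mphi <-].
  by move: phi mphi; near: n; exact: lower.
have := MMle n n0.
rewrite -(fineK (MRfin n n0)) -(fineK (MMfin n n0)) !lee_fin => h1 h2 h3.
rewrite sub0r normrN ger0_norm ?subr_ge0//; lra.
Unshelve. all: by end_near. Qed.
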